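(* Let $\psi$ be a regular colouring, and let $\xi=(\xi^a)_{a\ge0}\in\mathcal C_0$ be the unique regular summable solution of $\psi\ltimes\xi=\psi[+1]$. Consider the quotient of $\mathbb k\langle H,X^-,X^+\rangle[[h]]$ by the smallest $h$-adically closed two-sided ideal containing the relations $$[H,X^\pm]=\pm2X^\pm,\qquad X^+X^-=\sum_{a=0}^\infty(X^-)^a(X^+)^a\xi^a(H).$$ The assignment $H\mapsto H$, $X^\pm\mapsto X^\pm$ induces an isomorphism of $\mathbb k[[h]]$-algebras from this quotient onto $U_h(\psi)$.
   Context: $\mathbb k$ is a field of characteristic zero, and $\mathbb k[[h]]$ is the ring of formal power series over $\mathbb k$. For a $\mathbb k$-vector space $V_0$, $V_0[[h]]$ denotes the module of formal series $\sum_{m\ge0}v_mh^m$ with $v_m\in V_0$. $\mathfrak a$ is the Lie algebra over $\mathbb k$ generated by $H,X^-,X^+$ subject to $[H,X^\pm]=\pm2X^\pm$. We set $U_h(\mathfrak a):=U(\mathfrak a)[[h]]$. A colouring is a sequence $\psi=(\psi^k)_{k\ge1}$ of functions $\psi^k:\mathbb Z\to\mathbb k[[h]]$ satisfying: - (C1) $\psi^k(n)\equiv k(n-k+1)\bmod h$; - (C2) $\psi^{n+1}(n)=0$ for all $n\ge0$; - (C3) $\psi^{n+k+1}(n)=\psi^k(-n-2)$ for all $k\ge1$ and all $n\ge0$. Write $\psi^k(n)=\sum_m\psi^k_m(n)h^m$. The colouring $\psi$ is regular if, for each $m$, there is $P_m\in\mathbb k[x,y]$ with $\psi^k_m(n)=P_m(k,n)$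 for all $k\ge1$ and $n\in\mathbb Z$. $V_h(n,\psi)$ is the representation of $U_h(\mathfrak a)$ on $(\bigoplus_{k\ge0}\mathbb k b_k)[[h]]$ with the following action: - $H.b_k=(n-2k)b_k$; - $X^-.b_k=b_{k+1}$; - $X^+.b_0=0$, and $X^+.b_k=\psi^k(n)b_{k-1}$ for $k\ge1$. $U_h(\psi)$ is the quotient of $U_h(\mathfrak a)$ by the two-sided ideal of elements that act by zero on every $V_h(n,\psi)$, $n\in\mathbb Z$. Sequences. $\mathcal C_0$ is the module of sequences $f=(f^k)_{k\ge0}$ of functions $\mathbb Z\to\mathbb k[[h]]$, with $f^k(n)=\sum_mf^k_m(n)h^m$. - $f$ is summable if for each $m$ one has $f^k_m\equiv0$ for $k$ large. - $f$ is regular if each $f^k_m$ is a polynomial in $n$, of degree bounded independently of $k$ for each fixed $m$. - For regular $\xi$, set $\xi^a(H)=\sum_m\xi^a_m(H)h^m\in\mathbb k[H][[h]]$. $\psi[+1]\in\mathcal C_0$ is defined by $(\psi[+1])^k=\psi^{k+1}$. For $\xi\in\mathcal C_0$, $(\psi\ltimes\xi)^k(n)=\sum_{a=0}^k\big(\prod_{b=k-a+1}^k\psi^b(n)\big)\xi^a(n-2k)$, where the empty product is $1$. *)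

(* Defs.v *)
From HB Require Import structures.
From mathcomp Require Import all_boot all_order all_algebra.
Set Implicit Arguments. Unset Strict Implicit. Unset Printing Implicit Defensive.
Import Order.TTheory GRing.Theory Num.Theory.
Local Open Scope ring_scope.

Section Defs.
Variable K : fieldType.

Definition ps := nat -> K.
Definition pzero : ps := fun _ => 0.
Definition pconst (c : K) : ps := fun m => if m == 0%N then c else 0.
Definition pone : ps := pconst 1.
Definition pmul (f g : ps) : ps :=
  fun m => \sum_(i < m.+1) f i * g (m - i)%N.
Definition padd (f g : ps) : ps := fun m => f m + g m.

(* ---------- colourings: psi k n = psi^k(n), only k >= 1 is used ---------- *)
Definition colouring (psi : nat -> int -> ps) : Prop :=
  (forall (k : nat) (n : int), (1 <= k)%N ->
      psi k n 0%N = k%:R * (n%:~R - k%:R + 1)) /\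
  (forall (n : nat) (m : nat), psi n.+1 n%:Z m = 0) /\
  (forall (k n : nat) (m : nat), (1 <= k)%N ->
      psi (n + k + 1)%N n%:Z m = psi k (- n%:Z - 2) m).

Definition eval2 (P : {poly {poly K}}) (x y : K) : K := (P.[y%:P]).[x].

Definition regular_colouring (psi : nat -> int -> ps) : Prop :=
  exists P : nat -> {poly {poly K}},
    forall (m k : nat) (n : int), (1 <= k)%N ->
      psi k n m = eval2 (P m) k%:R n%:~R.

(* ---------- sequences in C_0: f a n = f^a(n), a >= 0 ---------- *)
Definition summable (f : nat -> int -> ps) : Prop :=
  forall m : nat, exists k0 : nat, forall (k : nat) (n : int),
    (k0 <= k)%N -> f k n m = 0.

Definition regular_with (f : nat -> int -> ps) (p : nat -> nat -> {poly K}) : Prop :=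
  (forall (a m : nat) (n : int), f a n m = (p a m).[n%:~R]) /\
  (forall m : nat, exists d : nat, forall a : nat, (size (p a m) <= d)%N).

Definition ps_prod (s : seq ps) : ps := foldr pmul pone s.

Definition ltimes (psi xi : nat -> int -> ps) (k : nat) (n : int) : ps :=
  fun m => \sum_(a < k.+1)
     pmul (ps_prod [seq psi b n | b <- iota (k - a + 1) a])
          (xi a (n - (2 * k)%N%:Z)) m.

(* letters: 0 = H, 1 = X^-, 2 = X^+ ; a word [:: g1; ...; gr] is g1 g2 ... gr.
   An element x is given by x m w = coefficient of h^m * w; for each m only
   finitely many words may have nonzero coefficient. *)
Definition word := seq 'I_3.
Definition fs := nat -> word -> K.

Definition lH : 'I_3 := inord 0.
Definition lXm : 'I_3 := inord 1.
Definition lXp : 'I_3 := inord 2.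

Definition bounded (x : fs) (L : nat -> nat) : Prop :=
  forall (m : nat) (w : word), x m w != 0 -> (size w <= L m)%N.
(* finite support in each h-degree (words over a 3-letter alphabet) *)
Definition isA (x : fs) : Prop := exists L, bounded x L.

Definition fzero : fs := fun _ _ => 0.
Definition fadd (x y : fs) : fs := fun m w => x m w + y m w.
Definition fsub (x y : fs) : fs := fun m w => x m w - y m w.
Definition fscale (c : K) (x : fs) : fs := fun m w => c * x m w.
Definition fmul (x y : fs) : fs :=
  fun m w => \sum_(i < m.+1) \sum_(s < (size w).+1)
                x i (take s w) * y (m - i)%N (drop s w).
Definition fgen (g : 'I_3) : fs :=
  fun m w => ((m == 0%N) && (w == [:: g]))%:R.

Definition fH := fgen lH.
Definition fXm := fgen lXm.
Definition fXp := fgen lXp.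

Definition rel1 : fs := fsub (fsub (fmul fH fXp) (fmul fXp fH)) (fscale 2 fXp).
Definition rel2 : fs := fadd (fsub (fmul fH fXm) (fmul fXm fH)) (fscale 2 fXm).
(* sum_{a>=0} (X^-)^a (X^+)^a xi^a(H), with xi^a(H) = sum_m (p a m)(H) h^m.
   The word (X^-)^a (X^+)^a H^j determines (a,j) uniquely, and a, j <= size w,
   so this is exactly the coefficient of h^m w in the (h-adically convergent)
   infinite sum. *)
Definition xisum (p : nat -> nat -> {poly K}) : fs :=
  fun m w => \sum_(a < (size w).+1) \sum_(j < (size w).+1)
     (w == nseq a lXm ++ nseq a lXp ++ nseq j lH)%:R * (p a m)`_j.
Definition rel3 (p : nat -> nat -> {poly K}) : fs := fsub (fmul fXp fXm) (xisum p).

Definition agree (N : nat) (x y : fs) : Prop :=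
  forall (m : nat) (w : word), (m < N)%N -> x m w = y m w.

Definition closed_ideal (J : fs -> Prop) : Prop :=
  (forall x, J x -> isA x) /\
  J fzero /\
  (forall x y, J x -> J y -> J (fadd x y)) /\
  (forall a x, isA a -> J x -> J (fmul a x) /\ J (fmul x a)) /\
  (forall x, isA x -> (forall N : nat, exists y, J y /\ agree N x y) -> J x).

Definition in_rel_ideal (p : nat -> nat -> {poly K}) (x : fs) : Prop :=
  forall J : fs -> Prop, closed_ideal J -> J rel1 -> J rel2 -> J (rel3 p) -> J x.

(* action of a generator on b_k : result is c * b_k' , returned as (k', c) *)
Definition gact (psi : nat -> int -> ps) (n : int) (g : 'I_3) (k : nat) : nat * ps :=
  match val g with
  | 0%N => (k, pconst (n - (2 * k)%N%:Z)%:~R)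
  | 1%N => (k.+1, pone)
  | _ => (k.-1, if k is 0%N then pzero else psi k n)
  end.

Definition wact (psi : nat -> int -> ps) (n : int) (w : word) (k : nat) : nat * ps :=
  foldr (fun g (p : nat * ps) =>
           let q := gact psi n g p.1 in (q.1, pmul p.2 q.2)) (k, pone) w.

Fixpoint allwords (l : nat) : seq word :=
  if l is l'.+1 then [seq g :: w | g <- enum 'I_3, w <- allwords l'] else [:: [::]].

(* coefficient of h^M b_j in x . b_k, where L bounds the support of x *)
Definition actcoef (psi : nat -> int -> ps) (n : int) (x : fs) (L : nat -> nat)
    (k j M : nat) : K :=
  \sum_(m < M.+1) \sum_(l < (L m).+1) \sum_(w <- allwords l)
     (if (wact psi n w k).1 == j then x m w * (wact psi n w k).2 (M - m)%N else 0).

Definition acts_zero (psi : nat -> int -> ps) (n : int) (x : fs) : Prop :=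
  forall L, bounded x L -> forall k j M : nat, actcoef psi n x L k j M = 0.

End Defs.

(* Main.v *)
Require Import Defs.
From HB Require Import structures.
From mathcomp Require Import all_boot all_order all_algebra.
From mathcomp Require Import boolp ring zify.
Import GRing.Theory.
Local Open Scope ring_scope.
Set Implicit Arguments. Unset Strict Implicit. Unset Printing Implicit Defensive.

(** The elements acting by zero on every V_h(n, psi) form a closed ideal; it
    contains the third relation because X^+ X^- b_k = psi^(k+1)(n) b_k, while the
    sum over a acts on b_k by (psi |x xi)^k(n).

    Conversely, reduce modulo h. The equation for xi forces xi^0 = H, xi^1 = 1
    and xi^a = 0 for a >= 2 modulo h, so the relations become those of sl_2 and
    every word is congruent to a combination of the monomials
    (X^-)^a (X^+)^b H^i. Acting on b_b for all large n shows that a combination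
    of these monomials that kills all the classical Verma modules vanishes.
    Hence an x acting by zero has the same constant term in h as some element j
    of the ideal; x - j is divisible by h, its quotient by h again acts by zero,
    and iterating approximates x h-adically by elements of the ideal. *)


(** * Power series and sums over words *)

Section PowerSeriesRing.
Variable K : fieldType.
Implicit Types f g h : ps K.

(** Coefficients of a product up to degree [M] depend only on the factors up to degree [M]. Ring
    identities for power series can thus be read off from polynomial truncations. *)
Lemma coef_pmul (P Q : {poly K}) f g M :
  (forall i, (i <= M)%N -> P`_i = f i) -> (forall i, (i <= M)%N -> Q`_i = g i) ->
  forall i, (i <= M)%N -> (P * Q)`_i = pmul f g i.
Proof.
move=> hP hQ i iM; rewrite coefM /pmul; apply: eq_bigr => j _.
by rewrite hP ?hQ // ?(leq_trans (leq_subr _ _)) // (leq_trans _ iM) // -ltnS.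
Qed.

Lemma coef_trunc f M i : (i <= M)%N -> (\poly_(j < M.+1) f j)`_i = f i.
Proof. by move=> iM; rewrite coef_poly ltnS iM. Qed.

Lemma pmulA : associative (@pmul K).
Proof.
move=> f g h; apply: funext => M; have t f' := @coef_trunc f' M.
rewrite -(coef_pmul (t f) (coef_pmul (t g) (t h)) (leqnn M)).
by rewrite -(coef_pmul (coef_pmul (t f) (t g)) (t h) (leqnn M)) mulrA.
Qed.

Lemma pmulC : commutative (@pmul K).
Proof.
move=> f g; apply: funext => M; have t f' := @coef_trunc f' M.
by rewrite -(coef_pmul (t f) (t g) (leqnn M)) mulrC (coef_pmul (t g) (t f)).
Qed.

Lemma pmul1 : left_id (@pone K) (@pmul K).
Proof.
move=> f; apply: funext => M; rewrite /pmul big_ord_recl big1 ?addr0.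
  by rewrite subn0 mul1r.
by move=> i _; rewrite /pone /pconst /= mul0r.
Qed.

Lemma pmulDl : left_distributive (@pmul K) (@padd K).
Proof.
move=> f g h; apply: funext => M; rewrite /pmul /padd -big_split.
by apply: eq_bigr => i _; rewrite mulrDl.
Qed.

Definition popp f : ps K := fun m => - f m.

(** Equality of functions [nat -> K] is decided classically. This gives [ps K] its commutative ring
    structure, hence big operators and [ring]. *)
HB.instance Definition _ := gen_eqMixin (ps K).
HB.instance Definition _ := gen_choiceMixin (ps K).

Lemma paddA : associative (@padd K).
Proof. by move=> f g h; apply: funext => m; exact: addrA. Qed.
Lemma paddC : commutative (@padd K).
Proof. by move=> f g; apply: funext => m; exact: addrC. Qed.
Lemma padd0 : left_id (@pzero K) (@padd K).
Proof. by move=> f; apply: funext => m; exact: add0r. Qed.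
Lemma paddN : left_inverse (@pzero K) popp (@padd K).
Proof. by move=> f; apply: funext => m; exact: addNr. Qed.

HB.instance Definition _ :=
  GRing.isZmodule.Build (ps K) paddA paddC padd0 paddN.

Lemma pone_neq0 : @pone K != 0.
Proof.
by apply/eqP => /(congr1 (fun f : ps K => f 0%N)) /eqP; rewrite /= oner_eq0.
Qed.

HB.instance Definition _ :=
  GRing.Zmodule_isComNzRing.Build (ps K) pmulA pmulC pmul1 pmulDl pone_neq0.

Lemma psM f g : pmul f g = f * g. Proof. by []. Qed.
Lemma ps_sum (I : Type) (r : seq I) (P : pred I) (F : I -> ps K) m :
  (\sum_(i <- r | P i) F i) m = \sum_(i <- r | P i) F i m.
Proof. by elim/big_rec2: _ => // i y1 y2 _ <-. Qed.

Lemma psM_low0 f g M : (forall i, (i <= M)%N -> f i = 0) -> (f * g) M = 0.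
Proof.
move=> f0; change (pmul f g M = 0); rewrite /pmul big1 // => i _.
by rewrite f0 ?mul0r // -ltnS.
Qed.

Lemma psM0 f g : (f * g) 0%N = f 0%N * g 0%N.
Proof. by change (pmul f g 0%N = f 0%N * g 0%N); rewrite /pmul big_ord1. Qed.

Lemma pconstX (c : K) i : (pconst c : ps K) ^+ i = pconst (c ^+ i).
Proof.
elim: i => [|i IH]; first by rewrite !expr0.
rewrite !exprS IH; apply: funext => m.
change (pmul (pconst c) (pconst (c ^+ i)) m = pconst (c * c ^+ i) m).
rewrite /pmul big_ord_recl big1 ?addr0 => [|j _]; last by rewrite mul0r.
by rewrite subn0 /pconst /=; case: eqP => //; rewrite mulr0.
Qed.

Lemma psMconst f (c : K) m : (f * pconst c) m = f m * c.
Proof.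
change (pmul f (pconst c) m = f m * c).
rewrite pmulC /pmul big_ord_recl big1 ?addr0 => [|j _]; last by rewrite mul0r.
by rewrite subn0 /pconst /= mulrC.
Qed.

Lemma ps_prodE (s : seq (ps K)) : ps_prod s = \prod_(f <- s) f.
Proof. by elim: s => [|f s IH]; rewrite ?big_nil // big_cons -IH. Qed.

End PowerSeriesRing.

Section WordSums.

Lemma eq_sum_bound (V : zmodType) (F : nat -> V) A B :
  (forall l, (A <= l)%N -> F l = 0) -> (forall l, (B <= l)%N -> F l = 0) ->
  \sum_(l < A) F l = \sum_(l < B) F l.
Proof.
move=> FA FB; wlog le : A B FA FB / (A <= B)%N.
  by case: (leqP A B) => [/[dup] le _ H|/ltnW le H]; [exact: H|symmetry; exact: H].
rewrite -!(big_mkord xpredT F) [RHS](big_cat_nat (n := A)) //=.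
suff -> : \sum_(A <= i < B) F i = 0 by rewrite addr0.
by rewrite big_nat_cond big1 // => i /andP[/andP[/FA]].
Qed.

Lemma allwords_size l w : w \in allwords l -> size w = l.
Proof.
elim: l w => [|l IH] w /=; first by rewrite inE => /eqP->.
by case/allpairsP => -[g v] /= [_ /IH <- ->].
Qed.

Lemma big_allwordsS (V : nmodType) l (F : word -> V) :
  \sum_(w <- allwords l.+1) F w = \sum_(g : 'I_3) \sum_(w <- allwords l) F (g :: w).
Proof. by rewrite /= big_allpairs_dep /= big_enum. Qed.

Lemma big_allwordsD (V : nmodType) s t (F : word -> V) :
  \sum_(w <- allwords (s + t)) F w =
  \sum_(u <- allwords s) \sum_(v <- allwords t) F (u ++ v).
Proof.
elim: s F => [|s IH] F; first by rewrite big_seq1.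
by rewrite addSn !big_allwordsS; apply: eq_bigr => g _; rewrite IH.
Qed.

(** This is how the proof uses that [allwords l] lists each word of length [l] exactly once. *)
Lemma big_allwords_delta (R : pzSemiRingType) l v (F : word -> R) :
  \sum_(w <- allwords l) (w == v)%:R * F w = if size v == l then F v else 0.
Proof.
elim: l v F => [|l IH] v F.
  by rewrite big_seq1; case: v => [|g v] /=; rewrite ?mul1r ?mul0r.
rewrite big_allwordsS; case: v => [|g v].
  by rewrite big1 // => g _; rewrite big1 // => w _; rewrite mul0r.
rewrite (bigD1 g) //= [X in _ + X]big1 ?addr0 => [|g' ne]; last first.
  by rewrite big1 // => w _; rewrite eqseq_cons (negbTE ne) mul0r.
under eq_bigr => w _ do rewrite eqseq_cons eqxx /=.
by rewrite IH eqSS.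
Qed.

(** The cut at length [B] (inclusive) stands for a sum over all words whenever [F] vanishes on
    longer ones; [wsum_bound] makes the choice of [B] immaterial. *)
Definition wsum (V : nmodType) B (F : word -> V) : V :=
  \sum_(l < B.+1) \sum_(w <- allwords l) F w.

Lemma eq_wsum (V : nmodType) B (F G : word -> V) : F =1 G -> wsum B F = wsum B G.
Proof. by move=> e; apply: eq_bigr => l _; apply: eq_bigr => w _; exact: e. Qed.

Lemma wsum0 (V : nmodType) B (F : word -> V) : (forall w, F w = 0) -> wsum B F = 0.
Proof. by move=> e; rewrite /wsum big1 // => l _; rewrite big1. Qed.

Lemma wsumD (V : nmodType) B (F G : word -> V) :
  wsum B (fun w => F w + G w) = wsum B F + wsum B G.
Proof. by rewrite /wsum -big_split; apply: eq_bigr => l _; rewrite big_split. Qed.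

Lemma wsum_sum (V : nmodType) (I : Type) (r : seq I) (P : pred I) B (F : I -> word -> V) :
  wsum B (fun w => \sum_(i <- r | P i) F i w) = \sum_(i <- r | P i) wsum B (F i).
Proof.
rewrite /wsum exchange_big; apply: eq_bigr => l _.
by rewrite exchange_big.
Qed.

Lemma wsumMl (R : pzSemiRingType) B (c : R) (F : word -> R) :
  wsum B (fun w => c * F w) = c * wsum B F.
Proof. by rewrite /wsum big_distrr; apply: eq_bigr => l _; rewrite big_distrr. Qed.

Lemma wsum_delta (R : pzSemiRingType) B v (F : word -> R) : (size v <= B)%N ->
  wsum B (fun w => (w == v)%:R * F w) = F v.
Proof.
move=> vB; rewrite /wsum (bigD1 (Ordinal (n := B.+1) (m := size v) vB)) //=.
rewrite big_allwords_delta eqxx big1 ?addr0 // => l ne.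
by rewrite big_allwords_delta; case: eqP => // e; case/eqP: ne; apply: val_inj.
Qed.

Lemma wsum_bound (V : zmodType) A B (F : word -> V) :
  (forall w, (A < size w)%N -> F w = 0) -> (forall w, (B < size w)%N -> F w = 0) ->
  wsum A F = wsum B F.
Proof.
move=> FA FB; apply: (@eq_sum_bound _ (fun l => \sum_(w <- allwords l) F w)) => l le;
rewrite big_seq big1 // => w /allwords_size e; [apply: FA|apply: FB]; by rewrite e.
Qed.

(** Substitute [l = s + t]: the rectangle lies inside the triangle, and [g] vanishes on the rest of
    the triangle. *)
Lemma triangular_sum (V : zmodType) (g : nat -> nat -> V) A B :
  (forall s t, (A < s)%N || (B < t)%N -> g s t = 0) ->
  \sum_(l < (A + B).+1) \sum_(s < l.+1) g s (l - s)%N =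
  \sum_(s < A.+1) \sum_(t < B.+1) g s t.
Proof.
move=> g0.
have -> : \sum_(l < (A + B).+1) \sum_(s < l.+1) g s (l - s)%N =
  \sum_(l < (A + B).+1) \sum_(s < A.+1) (if (s <= l)%N then g s (l - s)%N else 0).
  apply: eq_bigr => l _.
  (* Both ranges are compared with [maxn l A]: beyond [l] the conditional gives 0, beyond [A] the
     hypothesis on [g] does. *)
  rewrite -(@eq_sum_bound _ (fun s => if (s <= l)%N then g s (l - s)%N else 0) (maxn l A).+1).
  - rewrite (@eq_sum_bound _ (fun s => if (s <= l)%N then g s (l - s)%N else 0) _ l.+1).
    + by apply: eq_bigr => s _; rewrite -ltnS ltn_ord.
    + by move=> s; rewrite gtn_max => /andP[h _]; rewrite leqNgt h.
    + by move=> s h; rewrite leqNgt h.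
  - by move=> s; rewrite gtn_max => /andP[h _]; rewrite leqNgt h.
  - by move=> s h; rewrite g0 ?h // if_same.
rewrite exchange_big; apply: eq_bigr => s _ /=.
rewrite -(big_mkord xpredT (fun l => if (s <= l)%N then g s (l - s)%N else 0)).
have sA : (s <= A)%N by rewrite -ltnS.
rewrite (big_cat_nat (n := s)) //=; last by lia.
rewrite big_nat_cond big1 ?add0r => [|i /andP[/andP[_ h] _]]; last by rewrite leqNgt h.
rewrite -[X in \sum_(X <= _ < _) _]add0n big_addn big_mkord.
rewrite [LHS](eq_bigr (fun i => g s (nat_of_ord i))) => [|i _]; last first.
  by rewrite leq_addl addnK.
apply: (@eq_sum_bound _ (g s)) => t h; apply: g0; apply/orP; right; lia.
Qed.

(** Each pair of words occurs once as a cut of its concatenation, so the convolution defining [fmul]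
    becomes a double sum. *)
Lemma wsum_split (V : zmodType) (G : word -> word -> V) A B :
  (forall u v, (A < size u)%N || (B < size v)%N -> G u v = 0) ->
  wsum (A + B) (fun w => \sum_(s < (size w).+1) G (take s w) (drop s w)) =
  wsum A (fun u => wsum B (G u)).
Proof.
move=> G0; pose g s t := \sum_(u <- allwords s) \sum_(v <- allwords t) G u v.
transitivity (\sum_(s < A.+1) \sum_(t < B.+1) g s t); last first.
  by apply: eq_bigr => s _; rewrite exchange_big.
rewrite -triangular_sum; last first.
  move=> s t h; rewrite /g big_seq big1 // => u /allwords_size us.
  by rewrite big_seq big1 // => v /allwords_size vt; rewrite G0 // us vt.
apply: eq_bigr => l _; rewrite big_seq.
under eq_bigr => w /allwords_size wl do rewrite wl.
rewrite -big_seq exchange_big; apply: eq_bigr => s _ /=.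
have sl : (s <= l)%N by rewrite -ltnS.
rewrite -{1}(subnKC sl) big_allwordsD /g big_seq [RHS]big_seq.
apply: eq_bigr => u /allwords_size us; apply: eq_bigr => v _.
by rewrite -us take_size_cat // drop_size_cat.
Qed.

End WordSums.

(** * The action on the modules V_h(n, psi) *)

Section Letters.

Lemma letters_neq : [/\ lH == lXm = false, lH == lXp = false & lXm == lXp = false].
Proof. by rewrite -!val_eqE /= !inordK. Qed.

Lemma letterP (g : 'I_3) : [\/ g = lH, g = lXm | g = lXp].
Proof.
case: g => [[|[|[|//]]]] h; [constructor 1|constructor 2|constructor 3];
by apply: val_inj; rewrite /= inordK.
Qed.

Definition normal_word a b i : word := nseq a lXm ++ nseq b lXp ++ nseq i lH.

Lemma size_normal_word a b i : size (normal_word a b i) = (a + (b + i))%N.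
Proof. by rewrite !size_cat !size_nseq. Qed.

End Letters.

(** * Elements of the completed free algebra and the defining relations *)

Section Elements.
Variable K : fieldType.
Implicit Types (x y : fs K) (p : nat -> nat -> {poly K}).

(* In h-degrees up to M, only words of length at most B occur in x. *)
Definition supp_bound x M B := forall m w, (m <= M)%N -> (B < size w)%N -> x m w = 0.

Lemma supp_bound_le x M M' B : (M' <= M)%N -> supp_bound x M B -> supp_bound x M' B.
Proof. by move=> le h m w mM; apply: h; exact: leq_trans le. Qed.

Lemma supp_boundW x M B B' : (B <= B')%N -> supp_bound x M B -> supp_bound x M B'.
Proof. by move=> le h m w mM wB; apply: h => //; exact: leq_ltn_trans wB. Qed.

(** The coefficient of h^M in an action involves all degrees up to [M], so one bound for all of them
    is the convenient form. It is a maximum in one direction; the other uses choice. *)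
Lemma isAP x : isA x <-> forall M, exists B, supp_bound x M B.
Proof.
split=> [[L hL] M|h].
  exists (\max_(m < M.+1) L m) => m w mM wB; apply/eqP/contraT => /hL.
  rewrite leqNgt (leq_ltn_trans _ wB) //.
  by rewrite (leq_bigmax (F := fun m : 'I_M.+1 => L m) (Ordinal (n := M.+1) (m := m) mM)).
have [L hL] := choice h.
by exists L => m w nz; rewrite leqNgt; apply: contra nz => /(hL m) ->.
Qed.

Lemma supp_bound_mul a x M A B :
  supp_bound a M A -> supp_bound x M B -> supp_bound (fmul a x) M (A + B).
Proof.
move=> ha hx m w mM wB; rewrite /fmul big1 // => i _; rewrite big1 // => s _.
have iM : (i <= M)%N by rewrite (leq_trans _ mM) // -ltnS.
have miM : (m - i <= M)%N by rewrite (leq_trans (leq_subr _ _)).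
have := size_cat (take s w) (drop s w); rewrite cat_take_drop => e.
have /orP[h|h] : (A < size (take s w))%N || (B < size (drop s w))%N by lia.
  by rewrite ha // mul0r.
by rewrite hx // mulr0.
Qed.

Lemma isA_mul a x : isA a -> isA x -> isA (fmul a x).
Proof.
move=> /isAP ha /isAP hx; apply/isAP => M.
by have [[A hA] [B hB]] := (ha M, hx M); exists (A + B)%N; apply: supp_bound_mul.
Qed.

Lemma isA_lin x y (c : K) : isA x -> isA y -> isA (fun m w => x m w + c * y m w).
Proof.
move=> /isAP hx /isAP hy; apply/isAP => M.
have [[A hA] [B hB]] := (hx M, hy M); exists (maxn A B) => m w mM.
by rewrite gtn_max => /andP[h1 h2]; rewrite hA // hB // mulr0 addr0.
Qed.

Lemma fmul_fgen g x m w :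
  fmul (fgen K g) x m w = if w is c :: w' then (c == g)%:R * x m w' else 0.
Proof.
rewrite /fmul big_ord_recl [X in _ + X]big1 => [|i _]; last first.
  by rewrite big1 // => s _; rewrite /fgen /= mul0r.
rewrite addr0 subn0; case: w => [|c w]; first by rewrite big_ord1 /fgen /= mul0r.
rewrite big_ord_recl big_ord_recl big1 => [|s _]; last first.
  rewrite /fgen /= eqseq_cons; case: w s => [[[]] //|d w s].
  by rewrite andbF mul0r.
by rewrite /fgen /= mul0r add0r addr0 take0 drop0 eqseq_cons andbT.
Qed.

Definition delta (v : word) : word -> K := fun w => (w == v)%:R.

Lemma delta_cons g v w :
  (if w is c :: w' then (c == g)%:R * delta v w' else 0) = delta (g :: v) w.
Proof.
by case: w => [|c w] //=; rewrite /delta eqseq_cons; case: eqP; rewrite ?mul1r ?mul0r.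
Qed.

Lemma fgenE g m w : fgen K g m w = (m == 0%N)%:R * delta [:: g] w.
Proof. by rewrite /fgen /delta; case: eqP; rewrite ?mul1r ?mul0r. Qed.

Lemma fgen2E g g' m w :
  fmul (fgen K g) (fgen K g') m w = (m == 0%N)%:R * delta [:: g; g'] w.
Proof.
rewrite fmul_fgen -delta_cons; case: w => [|c w]; first by rewrite mulr0.
by rewrite fgenE mulrCA.
Qed.

Lemma rel1E m w : rel1 K m w = (m == 0%N)%:R *
  (delta [:: lH; lXp] w - delta [:: lXp; lH] w - 2 * delta [:: lXp] w).
Proof. by rewrite /rel1 /fsub /fscale !fgen2E /fXp /fXm fgenE; ring. Qed.

Lemma rel2E m w : rel2 K m w = (m == 0%N)%:R *
  (delta [:: lH; lXm] w - delta [:: lXm; lH] w + 2 * delta [:: lXm] w).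
Proof. by rewrite /rel2 /fadd /fsub /fscale !fgen2E /fXp /fXm fgenE; ring. Qed.

Lemma rel3E p m w : rel3 p m w =
  (m == 0%N)%:R * delta [:: lXp; lXm] w - xisum p m w.
Proof. by rewrite /rel3 /fsub fgen2E. Qed.

Lemma delta_size v w : (size v < size w)%N -> delta v w = 0.
Proof. by rewrite /delta; case: eqP => // ->; rewrite ltnn. Qed.

Lemma supp_bound_rel1 M : supp_bound (rel1 K) M 2.
Proof.
move=> m w _ h; rewrite rel1E !delta_size // ?(ltn_trans _ h) //.
by rewrite mulr0 !subr0 mulr0.
Qed.

Lemma supp_bound_rel2 M : supp_bound (rel2 K) M 2.
Proof.
move=> m w _ h; rewrite rel2E !delta_size // ?(ltn_trans _ h) //.
by rewrite mulr0 !subr0 addr0 mulr0.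
Qed.

(** The ranges in [xisum] depend on the word. Ranges independent of [w] allow the sums over [a] and
    [i] to be exchanged with sums over words. *)
Lemma xisum_bounded p M A D m w : (m <= M)%N ->
  (forall a m, (m <= M)%N -> (A <= a)%N -> p a m = 0) ->
  (forall a m, (m <= M)%N -> (size (p a m) <= D)%N) ->
  xisum p m w =
  \sum_(a < A) \sum_(i < D) (p a m)`_i * ((w == normal_word a a i)%:R : K).
Proof.
move=> mM hA hD; pose F a i := (p a m)`_i * ((w == normal_word a a i)%:R : K).
have F0 a i : (size w < a + (a + i))%N -> F a i = 0.
  rewrite -size_normal_word /F; case: eqP => [->|]; first by rewrite ltnn.
  by rewrite mulr0.
have FA a i : (A <= a)%N -> F a i = 0 by move=> h; rewrite /F hA // coef0 mul0r.
have FD a i : (D <= i)%N -> F a i = 0.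
  by move=> h; rewrite /F nth_default ?mul0r // (leq_trans (hD _ _ mM)).
transitivity (\sum_(a < (size w).+1) \sum_(i < (size w).+1) F a i).
  by apply: eq_bigr => a _; apply: eq_bigr => i _; rewrite mulrC.
rewrite (@eq_sum_bound _ (fun a => \sum_(i < (size w).+1) F a i) _ A) => [|a h|a h].
- apply: eq_bigr => a _; apply: (@eq_sum_bound _ (F a)) => i h; first by apply: F0; lia.
  exact: FD.
- by rewrite big1 // => i _; apply: F0; lia.
- by rewrite big1 // => i _; apply: FA.
Qed.

Lemma supp_bound_xisum p M A D :
  (forall a m, (m <= M)%N -> (A <= a)%N -> p a m = 0) ->
  (forall a m, (m <= M)%N -> (size (p a m) <= D)%N) ->
  supp_bound (xisum p : fs K) M (A + (A + D)).
Proof.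
move=> hA hD m w mM h; rewrite (xisum_bounded w mM hA hD) big1 // => a _.
rewrite big1 // => i _; case: eqP => [e|]; last by rewrite mulr0.
have [aA iD] := (ltn_ord a, ltn_ord i).
by move: h; rewrite e size_normal_word; lia.
Qed.

End Elements.

Section Action.
Variables (K : fieldType) (psi : nat -> int -> ps K) (n : int).
Implicit Types (x y : fs K) (p : nat -> nat -> {poly K}).

(* The coefficient of b_j in w . b_k. *)
Definition wcoef w (k j : nat) : ps K :=
  if (wact psi n w k).1 == j then (wact psi n w k).2 else 0.

(* The coefficient of h^M b_j in x . b_k, provided supp_bound x M B. *)
Definition act B x k j M : K :=
  wsum B (fun w => (((fun m => x m w) : ps K) * wcoef w k j) M).

Definition annihilates x := forall k j M B, supp_bound x M B -> act B x k j M = 0.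

Lemma actcoefE x L k j M B : bounded x L -> supp_bound x M B ->
  actcoef psi n x L k j M = act B x k j M.
Proof.
move=> hL hB.
transitivity (\sum_(m < M.+1) wsum B (fun w => x m w * wcoef w k j (M - m)%N)); last first.
  by rewrite -wsum_sum; apply: eq_wsum.
apply: eq_bigr => m _.
have e w : (if (wact psi n w k).1 == j then x m w * (wact psi n w k).2 (M - m)%N else 0) =
   x m w * wcoef w k j (M - m)%N.
  by rewrite /wcoef; case: eqP => // _; rewrite mulr0.
under eq_bigr => l _ do under eq_bigr => w _ do rewrite e.
apply: (@wsum_bound _ (L m)) => w h; last by rewrite hB ?mul0r // -ltnS.
suff /eqP-> : x m w == 0 by rewrite mul0r.
by apply: contraTT h => /hL; rewrite leqNgt.
Qed.

Lemma acts_zeroP x : isA x -> (acts_zero psi n x <-> annihilates x).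
Proof.
move=> hx; split=> h; last first.
  move=> L hL k j M; have /isAP/(_ M)[B hB] := hx.
  by rewrite (actcoefE _ _ hL hB) h.
move=> k j M B hB; case: hx => L hL.
by rewrite -(actcoefE _ _ hL hB) h.
Qed.

Lemma act_lin B x y (c : K) k j M :
  act B (fun m w => x m w + c * y m w) k j M = act B x k j M + c * act B y k j M.
Proof.
rewrite /act -wsumMl -wsumD; apply: eq_wsum => w.
change (pmul (fun m => x m w + c * y m w) (wcoef w k j) M =
  pmul (x ^~ w) (wcoef w k j) M + c * pmul (y ^~ w) (wcoef w k j) M).
rewrite /pmul big_distrr -big_split; apply: eq_bigr => i _ /=.
by rewrite mulrDl mulrA.
Qed.

Lemma eq_act B x y k j M : (forall m w, (m <= M)%N -> x m w = y m w) ->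
  act B x k j M = act B y k j M.
Proof.
move=> e; apply: eq_wsum => w; apply: eq_bigr => i _.
by rewrite e // -ltnS.
Qed.

Lemma act_widen x B B' k j M : supp_bound x M B -> (B <= B')%N ->
  act B x k j M = act B' x k j M.
Proof.
move=> h le; apply: wsum_bound => w hw; apply: psM_low0 => i iM; apply: h => //.
exact: leq_ltn_trans hw.
Qed.

Lemma annihilates_lin x y (c : K) : isA x -> isA y -> annihilates x -> annihilates y ->
  annihilates (fun m w => x m w + c * y m w).
Proof.
move=> /isAP hx /isAP hy kx ky k j M B hB.
(* [B] bounds only the combination; long words of [x] and [y] may cancel in it, so the bound is
   enlarged before splitting. *)
have [[A1 h1] [A2 h2]] := (hx M, hy M); pose N := maxn B (maxn A1 A2).
rewrite (act_widen (B' := N)) //; last by rewrite leq_max leqnn.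
rewrite act_lin kx ?ky ?mulr0 ?addr0 //.
  by apply: supp_boundW h2; rewrite !leq_max leqnn !orbT.
by apply: supp_boundW h1; rewrite !leq_max leqnn !orbT.
Qed.

Lemma annihilates_limit x :
  (forall N, exists y, [/\ isA y, annihilates y & agree N x y]) -> annihilates x.
Proof.
move=> h k j M B hB; have [y [_ ky e]] := h M.+1.
rewrite (eq_act _ _ _ (y := y)) => [|m w mM]; last exact: e.
by apply: ky => m w mM hw; rewrite -e // hB.
Qed.

Lemma wact_cat u v k : wact psi n (u ++ v) k =
  ((wact psi n u (wact psi n v k).1).1,
   (wact psi n v k).2 * (wact psi n u (wact psi n v k).1).2).
Proof.
elim: u => [|g u IH] /=; first by rewrite mulr1 -surjective_pairing.
by rewrite IH /= psM !mulrA.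
Qed.

Lemma wact_pos v k : ((wact psi n v k).1 <= k + size v)%N.
Proof.
elim: v => [|g v IH] /=; first by rewrite addn0.
by rewrite /gact; case: (val g) => [|[|?]] /=; lia.
Qed.

Lemma wcoef_cat u v k j :
  wcoef (u ++ v) k j = (wact psi n v k).2 * wcoef u (wact psi n v k).1 j.
Proof. by rewrite /wcoef wact_cat /=; case: eqP => //; rewrite mulr0. Qed.

(** Matrix multiplication: a word sends [b_k] to a multiple of one basis vector, of index at most
    [k + size v], so a single term survives. *)
Lemma wcoef_cat_sum u v k j N : (k + size v <= N)%N ->
  wcoef (u ++ v) k j = \sum_(l < N.+1) wcoef v k l * wcoef u l j.
Proof.
move=> h; have lt : ((wact psi n v k).1 < N.+1)%N.
  by rewrite ltnS (leq_trans (wact_pos v k)).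
rewrite (bigD1 (Ordinal lt)) //= big1 ?addr0 => [|l ne].
  by rewrite wcoef_cat {2}/wcoef eqxx.
rewrite /wcoef; case: eqP => [e|]; last by rewrite mul0r.
by case/eqP: ne; apply: val_inj.
Qed.

Lemma wsum_ps B (F : word -> ps K) M : wsum B F M = wsum B (fun w => F w M).
Proof. by rewrite /wsum ps_sum; apply: eq_bigr => l _; rewrite ps_sum. Qed.

Lemma act_mul a x A B k j M : supp_bound a M A -> supp_bound x M B ->
  act (A + B) (fmul a x) k j M =
  wsum A (fun u => wsum B (fun v =>
    (((fun m => a m u) : ps K) * ((fun m => x m v) : ps K) * wcoef (u ++ v) k j) M)).
Proof.
move=> ha hx; rewrite -wsum_split => [|u v]; last first.
  case/orP => h; first by rewrite -mulrA; apply: psM_low0 => i iM; exact: ha.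
  by rewrite [X in X * _]mulrC -mulrA; apply: psM_low0 => i iM; exact: hx.
apply: eq_wsum => w.
under [RHS]eq_bigr => s _ do rewrite cat_take_drop.
pose F s : ps K := (a^~ (take s w) : ps K) * (x^~ (drop s w) : ps K).
transitivity ((\sum_(s < (size w).+1) F s * wcoef w k j) M); last by rewrite ps_sum.
rewrite -big_distrl /=; congr (pmul _ _ M).
apply: funext => m; rewrite ps_sum /F [LHS]exchange_big.
by apply: eq_bigr => s _.
Qed.

Lemma eq_wsum_in (V : nmodType) B (F G : word -> V) :
  (forall w, (size w <= B)%N -> F w = G w) -> wsum B F = wsum B G.
Proof.
move=> e; apply: eq_bigr => l _; rewrite big_seq [RHS]big_seq.
by apply: eq_bigr => w /allwords_size sw; rewrite e // sw -ltnS.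
Qed.

(** For [fmul a x], the vector [x . b_k] is already zero. For [fmul x a], each word of [a] sends
    [b_k] to a multiple of one basis vector, which [x] kills. *)
Lemma annihilates_mul a x : isA a -> isA x -> annihilates x ->
  annihilates (fmul a x) /\ annihilates (fmul x a).
Proof.
move=> /isAP ha /isAP hx kx; split=> k j M B hB;
have [[A1 h1] [A2 h2]] := (ha M, hx M).
- pose N := maxn B (A1 + A2).
  rewrite (act_widen (B' := N)) // ?leq_maxl //.
  rewrite -(act_widen (B := A1 + A2)) ?leq_maxr //; last exact: supp_bound_mul.
  rewrite act_mul //; apply: wsum0 => u.
  under eq_wsum_in => v hv do rewrite (wcoef_cat_sum u j (N := k + A2)) ?leq_add2l //.
  rewrite -(wsum_ps _ (fun v => (a^~ u : ps K) * (x^~ v : ps K) *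
       (\sum_(l < (k + A2).+1) wcoef v k l * wcoef u l j))).
  (* With [u] fixed, the coefficients of the [b_l] in [x . b_k] are factored out; they vanish up to
     degree [M]. *)
  have -> : wsum A2 (fun v => ((a^~ u : ps K) * (x^~ v : ps K) *
       (\sum_(l < (k + A2).+1) wcoef v k l * wcoef u l j))) =
    \sum_(l < (k + A2).+1) wsum A2 (fun v => (x^~ v : ps K) * wcoef v k l) *
      ((a^~ u : ps K) * wcoef u l j).
    under [RHS]eq_bigr => l _ do rewrite mulrC -wsumMl.
    rewrite -wsum_sum; apply: eq_wsum => v; rewrite big_distrr.
    by apply: eq_bigr => l _ /=; ring.
  rewrite ps_sum big1 // => l _; apply: psM_low0 => i iM; rewrite wsum_ps.
  by apply: kx; apply: supp_bound_le h2.
- pose N := maxn B (A2 + A1).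
  rewrite (act_widen (B' := N)) // ?leq_maxl //.
  rewrite -(act_widen (B := A2 + A1)) ?leq_maxr //; last exact: supp_bound_mul.
  rewrite act_mul // /wsum.
  (* The sums are exchanged so that the word [v] of [a] is fixed and [x] acts on a single basis
     vector. *)
  under eq_bigr => l _ do rewrite exchange_big.
  rewrite exchange_big big1 // => l _ /=.
  under eq_bigr => l' _ do rewrite exchange_big.
  rewrite exchange_big big1 // => v _ /=.
  change (wsum A2 (fun u => ((x^~ u : ps K) * (a^~ v : ps K) * wcoef (u ++ v) k j) M) = 0).
  under eq_wsum => u do rewrite wcoef_cat.
  rewrite -(wsum_ps _ (fun u => (x^~ u : ps K) * (a^~ v : ps K) *
       ((wact psi n v k).2 * wcoef u (wact psi n v k).1 j))).
  have -> : wsum A2 (fun u => (x^~ u : ps K) * (a^~ v : ps K) *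
       ((wact psi n v k).2 * wcoef u (wact psi n v k).1 j)) =
    wsum A2 (fun u => (x^~ u : ps K) * wcoef u (wact psi n v k).1 j) *
      ((a^~ v : ps K) * (wact psi n v k).2).
    by rewrite mulrC -wsumMl; apply: eq_wsum => u; ring.
  apply: psM_low0 => i iM; rewrite wsum_ps.
  by apply: kx; apply: supp_bound_le h2.
Qed.

(** The scalar in the action of X^+ on [b_k]. Its value 0 at [k = 0] makes the truncated index
    [k.-1] harmless. *)
Definition qXp k : ps K := if k is 0%N then 0 else psi k n.

Lemma gactH k : gact psi n lH k = (k, pconst (n - (2 * k)%N%:Z)%:~R).
Proof. by rewrite /gact /= inordK. Qed.
Lemma gactXm k : gact psi n lXm k = (k.+1, 1).
Proof. by rewrite /gact /= inordK. Qed.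
Lemma gactXp k : gact psi n lXp k = (k.-1, qXp k).
Proof. by rewrite /gact /= inordK. Qed.

Lemma act_delta B v k j M : (size v <= B)%N ->
  act B (fun m w => (m == 0%N)%:R * delta K v w) k j M = wcoef v k j M.
Proof.
move=> h; rewrite -[RHS](wsum_delta (fun w => wcoef w k j M) h).
apply: eq_wsum => w; change (pmul (fun m => (m == 0%N)%:R * delta K v w) (wcoef w k j) M =
  (w == v)%:R * wcoef w k j M).
rewrite /pmul big_ord_recl big1 ?addr0 => [|i _]; last by rewrite /= !mul0r.
by rewrite mul1r subn0.
Qed.

Lemma wact_cons g w k : wact psi n (g :: w) k =
  ((gact psi n g (wact psi n w k).1).1,
   (wact psi n w k).2 * (gact psi n g (wact psi n w k).1).2).
Proof. by []. Qed.

Lemma wact_nil k : wact psi n [::] k = (k, 1). Proof. by []. Qed.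

Lemma annihilates_rel1 : annihilates (rel1 K).
Proof.
move=> k j M B hB.
rewrite (act_widen (B' := maxn B 2)) ?leq_maxl // -(act_widen (B := 2)) ?leq_maxr //;
  last exact: supp_bound_rel1.
have -> : act 2 (rel1 K) k j M =
   wcoef [:: lH; lXp] k j M + (-1) * wcoef [:: lXp; lH] k j M + (-2) * wcoef [:: lXp] k j M.
  rewrite -!(@act_delta 2) // -!act_lin; apply: eq_act => m w _.
  by rewrite rel1E; ring.
rewrite /wcoef !wact_cons wact_nil !(gactH, gactXp) /=.
case: eqP => _; last by rewrite !mulr0 !addr0.
rewrite !mul1r [pconst _ * _]mulrC !psMconst.
(* At [k = 0] the truncated predecessor gives the wrong weight, but every term carries the factor
   [qXp 0 = 0]. *)
case: k => [|k] /=; first by rewrite -![(0 : ps K) M]/(0 : K) !mulr0 !mul0r mulr0 !addr0.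
rewrite (_ : (n - (2 * k)%N%:Z)%:~R = (n - (2 * k.+1)%N%:Z)%:~R + 2 :> K); first by ring.
rewrite -[2 in RHS]/(2%:~R) -intrD; congr (_ %:~R); lia.
Qed.

Lemma annihilates_rel2 : annihilates (rel2 K).
Proof.
move=> k j M B hB.
rewrite (act_widen (B' := maxn B 2)) ?leq_maxl // -(act_widen (B := 2)) ?leq_maxr //;
  last exact: supp_bound_rel2.
have -> : act 2 (rel2 K) k j M =
   wcoef [:: lH; lXm] k j M + (-1) * wcoef [:: lXm; lH] k j M + 2 * wcoef [:: lXm] k j M.
  rewrite -!(@act_delta 2) // -!act_lin; apply: eq_act => m w _.
  by rewrite rel2E; ring.
rewrite /wcoef !wact_cons wact_nil !(gactH, gactXm) /=.
case: eqP => _; last by rewrite !mulr0 !addr0.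
rewrite !mulr1 psMconst mul1r.
have -> (c : K) : pconst c M = (1 : ps K) M * c by rewrite -psMconst mul1r.
rewrite (_ : (n - (2 * k)%N%:Z)%:~R = (n - (2 * k.+1)%N%:Z)%:~R + 2 :> K); first by ring.
rewrite -[2 in RHS]/(2%:~R) -intrD; congr (_ %:~R); lia.
Qed.

(** For [b > k] the truncated index is meaningless, but the product then contains [qXp 0 = 0]. *)
Lemma wact_normal a b i k : wact psi n (normal_word a b i) k =
  ((k - b + a)%N,
   pconst ((n - (2 * k)%N%:Z)%:~R ^+ i) * \prod_(r < b) qXp (k - r)).
Proof.
have hH : wact psi n (nseq i lH) k = (k, pconst ((n - (2 * k)%N%:Z)%:~R ^+ i)).
  elim: i => [|i IH]; first by rewrite wact_nil expr0.
  by rewrite [nseq _ _]/= wact_cons IH gactH /= -!pconstX exprSr.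
have hp : wact psi n (nseq b lXp) k = ((k - b)%N, \prod_(r < b) qXp (k - r)).
  elim: b => [|b IH]; first by rewrite wact_nil subn0 big_ord0.
  by rewrite [nseq _ _]/= wact_cons IH gactXp /= big_ord_recr /= subnS.
have hm c : wact psi n (nseq a lXm) c = ((c + a)%N, 1).
  elim: a => [|a IH]; first by rewrite wact_nil addn0.
  by rewrite [nseq _ _]/= wact_cons IH gactXm /= mulr1 addnS.
by rewrite /normal_word !wact_cat hH /= hp hm mulr1.
Qed.

Lemma prod_qXp_gt b k : (k < b)%N -> \prod_(r < b) qXp (k - r) = 0.
Proof.
by move=> h; rewrite (bigD1 (Ordinal h)) //= subnn mul0r.
Qed.

Lemma prod_qXp b k : (b <= k)%N ->
  \prod_(r < b) qXp (k - r) = ps_prod [seq psi c n | c <- iota (k - b + 1) b].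
Proof.
rewrite ps_prodE big_map; elim: b => [|b IH] h; first by rewrite big_ord0 big_nil.
rewrite big_ord_recr /= IH 1?ltnW // big_cons mulrC.
have -> : (k - b + 1 = (k - b.+1 + 1).+1)%N by lia.
by rewrite (_ : (k - b = (k - b.+1).+1)%N) ?addn1 //; lia.
Qed.

(** (X^-)^a (X^+)^a returns [b_k] to itself times a product of values of [psi], while the powers of
    H evaluate [p a m] at the weight [n - 2k]. Together these are the terms of [ltimes]. *)
Lemma act_xisum (xi : nat -> int -> ps K) p A D B M k j :
  (forall a m z, xi a z m = (p a m).[z%:~R]) ->
  (forall a m, (m <= M)%N -> (A <= a)%N -> p a m = 0) ->
  (forall a m, (m <= M)%N -> (size (p a m) <= D)%N) ->
  (A + (A + D) <= B)%N ->
  act B (xisum p) k j M = if k == j then ltimes psi xi k n M else 0.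
Proof.
move=> hp hA hD hB; set z := n - (2 * k)%N%:Z.
pose E a : ps K := if k == j then \prod_(r < a) qXp (k - r) else 0.
have wcoefE a i m : wcoef (normal_word a a i) k j m = E a m * z%:~R ^+ i.
  rewrite -psMconst mulrC /wcoef /E wact_normal /= -/z.
  case: (leqP a k) => [le|gt]; first by rewrite subnK //; case: eqP; rewrite // mulr0.
  by rewrite prod_qXp_gt // mulr0 !if_same mulr0.
transitivity (\sum_(a < A) (xi a z * E a) M); last first.
  (* Terms with [a >= A] vanish by the choice of [A], those with [a > k] because (X^+)^a kills
     [b_k]. *)
  rewrite (@eq_sum_bound _ (fun a => (xi a z * E a) M) A k.+1) => [|a aA|a ak].
  - rewrite /ltimes; case: eqP => [ekj|ne]; last first.
      by rewrite big1 // => a _; rewrite /E; case: eqP => // _; rewrite mulr0.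
    apply: eq_bigr => a _; have ak : (a <= k)%N by rewrite -ltnS.
    by rewrite psM /E -ekj eqxx prod_qXp // mulrC.
  - by apply: psM_low0 => m mM; rewrite hp hA // horner0.
  - by rewrite /E prod_qXp_gt // if_same mulr0.
have eM a : (xi a z * E a) M =
    \sum_(m < M.+1) \sum_(i < D) (p a m)`_i * wcoef (normal_word a a i) k j (M - m)%N.
  change (pmul (xi a z) (E a) M =
    \sum_(m < M.+1) \sum_(i < D) (p a m)`_i * wcoef (normal_word a a i) k j (M - m)%N).
  apply: eq_bigr => m _; have mM : (m <= M)%N by rewrite -ltnS.
  rewrite hp (@horner_coef_wide _ D) ?hD // big_distrl.
  by apply: eq_bigr => i _; rewrite wcoefE /=; ring.
under [RHS]eq_bigr => a _ do rewrite eM.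
rewrite exchange_big /=.
transitivity (\sum_(m < M.+1) wsum B (fun w => xisum p m w * wcoef w k j (M - m)%N)).
  by rewrite -wsum_sum; apply: eq_wsum.
apply: eq_bigr => m _; have mM : (m <= M)%N by rewrite -ltnS.
under eq_wsum => w do rewrite (xisum_bounded w mM hA hD) big_distrl.
rewrite wsum_sum; apply: eq_bigr => a _ /=.
under eq_wsum => w do rewrite big_distrl.
rewrite wsum_sum; apply: eq_bigr => i _ /=.
under eq_wsum => w do rewrite -mulrA.
rewrite wsumMl wsum_delta // size_normal_word (leq_trans _ hB) //.
by have [aA iD] := (ltn_ord a, ltn_ord i); lia.
Qed.

End Action.

(** * The relation ideal acts by zero *)

Section CharZero.
Variables (K : fieldType) (char0 : [pchar K] =i pred0).

Lemma natr_inj0 : injective (fun n : nat => n%:R : K).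
Proof.
move=> i j e; wlog le : i j e / (i <= j)%N.
  by case: (leqP i j) => [/[swap] h|/ltnW /[swap] h]; [exact: h|move=> ?; symmetry; exact: h].
have /(pcharf0P K)/(_ (j - i)%N) := char0.
by rewrite natrB // e subrr eqxx; lia.
Qed.

Lemma poly_eq0_nat (q : {poly K}) (c : K) :
  (forall N : nat, q.[N%:R + c] = 0) -> q = 0.
Proof.
move=> h; apply/eqP/contraT => nz.
have := @max_poly_roots _ q [seq N%:R + c | N <- iota 0 (size q)] nz.
rewrite size_map size_iota ltnn; apply.
  by apply/allP => _ /mapP[N _ ->]; apply/rootP.
by rewrite map_inj_uniq ?iota_uniq // => i j /addIr /natr_inj0.
Qed.

(** Characteristic zero provides infinitely many distinct roots. The threshold [z] is there because
    the scalars to be cancelled are known to be nonzero only for large [n]. *)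
Lemma poly_eq0_int (q : {poly K}) (z : int) :
  (forall n : int, (z <= n)%R -> q.[n%:~R] = 0) -> q = 0.
Proof.
move=> h; apply: (@poly_eq0_nat _ z%:~R) => N.
by rewrite -[N%:R]/(N%:Z%:~R) -intrD h //; lia.
Qed.

Lemma intr_neq0 (z : int) : (0 < z)%R -> z%:~R != 0 :> K.
Proof.
case: z => // -[|N] // _; rewrite -[_%:~R]/(N.+1%:R : K).
by apply/eqP => /(@natr_inj0 _ 0%N).
Qed.

End CharZero.

Section Regular.
Variables (K : fieldType) (char0 : [pchar K] =i pred0).
Variables (xi : nat -> int -> ps K) (p : nat -> nat -> {poly K}).
Hypotheses (Hreg : regular_with xi p) (Hsum : summable xi).

(** Summability makes the values of [p a m] vanish for large [a], hence the polynomial itself in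
    characteristic zero; regularity bounds the degrees. Maxima over [m <= M] make both uniform. *)
Lemma p_bounds M : exists A D,
  (forall a m, (m <= M)%N -> (A <= a)%N -> p a m = 0) /\
  (forall a m, (m <= M)%N -> (size (p a m) <= D)%N).
Proof.
case: Hreg => hp hd.
have [f hf] := choice Hsum; have [g hg] := choice hd.
exists (\max_(m < M.+1) f m), (\max_(m < M.+1) g m); split=> a m mM.
  move=> h; apply: (poly_eq0_int char0 (z := 0)) => n _; rewrite -hp; apply: hf.
  apply: leq_trans h.
  exact: (leq_bigmax (F := fun m : 'I_M.+1 => f m) (Ordinal (n := M.+1) (m := m) mM)).
apply: leq_trans (hg m a) _.
exact: (leq_bigmax (F := fun m : 'I_M.+1 => g m) (Ordinal (n := M.+1) (m := m) mM)).
Qed.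

Lemma isA_xisum : isA (xisum p : fs K).
Proof.
apply/isAP => M; have [A [D [hA hD]]] := p_bounds M.
by exists (A + (A + D))%N; apply: supp_bound_xisum.
Qed.

Lemma isA_rel1 : isA (rel1 K).
Proof. by apply/isAP => M; exists 2%N; exact: supp_bound_rel1. Qed.

Lemma isA_rel2 : isA (rel2 K).
Proof. by apply/isAP => M; exists 2%N; exact: supp_bound_rel2. Qed.

Lemma supp_bound_delta M v : supp_bound (fun m w => (m == 0%N)%:R * delta K v w) M (size v).
Proof. by move=> m w _ h; rewrite delta_size // mulr0. Qed.

Lemma rel3_lin : rel3 p = fun m w =>
  (m == 0%N)%:R * delta K [:: lXp; lXm] w + (-1) * xisum p m w.
Proof. by apply: funext => m; apply: funext => w; rewrite rel3E mulN1r. Qed.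

Lemma isA_rel3 : isA (rel3 p).
Proof.
rewrite rel3_lin; apply: isA_lin isA_xisum.
by apply/isAP => M; exists 2%N; exact: supp_bound_delta.
Qed.

Variable psi : nat -> int -> ps K.
Hypothesis Hsol : forall k n m, ltimes psi xi k n m = psi k.+1 n m.

Lemma annihilates_rel3 n : annihilates psi n (rel3 p).
Proof.
move=> k j M B hB; have [A [D [hA hD]]] := p_bounds M.
pose N := maxn B (2 + (A + (A + D)))%N.
rewrite (act_widen _ _ (B' := N)) ?leq_maxl // rel3_lin act_lin.
rewrite act_delta; last by rewrite /N /=; lia.
rewrite (act_xisum _ _ _ _ (proj1 Hreg) hA hD); last by rewrite /N; lia.
rewrite /wcoef !wact_cons wact_nil gactXm gactXp /= !mul1r Hsol.
by case: eqP => _; rewrite mulN1r ?subrr // oppr0 addr0.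
Qed.

Definition kernel (x : fs K) := isA x /\ forall n, annihilates psi n x.

Lemma isA0 : isA (@fzero K).
Proof. by exists (fun _ => 0%N) => m w; rewrite eqxx. Qed.

Lemma faddE (x y : fs K) : fadd x y = fun m w => x m w + 1 * y m w.
Proof. by apply: funext => m; apply: funext => w; rewrite mul1r. Qed.

Lemma closed_kernel : closed_ideal kernel.
Proof.
split; [by move=> x []|split; [|split; [|split]]].
- by split; [exact: isA0|move=> n k j M B _; apply: wsum0 => w; apply: psM_low0].
- move=> x y [ax kx] [ay ky]; rewrite faddE; split; first exact: isA_lin.
  by move=> n; apply: annihilates_lin.
- move=> a x aa [ax kx]; split; split; try exact: isA_mul.
    by move=> n; have [] := annihilates_mul aa ax (kx n).
  by move=> n; have [] := annihilates_mul aa ax (kx n).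
- move=> x ax h; split=> // n; apply: annihilates_limit => N.
  by have [y [[ay ky] e]] := h N; exists y.
Qed.

(** [in_rel_ideal] quantifies over all closed ideals containing the relations, and the kernel is one
    of them. *)
Lemma rel_ideal_kernel x : in_rel_ideal p x -> kernel x.
Proof.
move=> /(_ _ closed_kernel); apply; split.
- exact: isA_rel1.
- by move=> n; exact: annihilates_rel1.
- exact: isA_rel2.
- by move=> n; exact: annihilates_rel2.
- exact: isA_rel3.
- exact: annihilates_rel3.
Qed.

(** Closed ideals are stable under intersection; the support condition [isA] is inherited from the
    kernel, one member of the family. *)
Lemma closed_rel_ideal : closed_ideal (in_rel_ideal p).
Proof.
split; [by move=> x /rel_ideal_kernel []|split; [|split; [|split]]].
- by move=> J [_ [? _]].
- by move=> x y hx hy J cJ r1 r2 r3; have [_ [_ [hD _]]] := cJ; apply: hD;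
  [apply: hx|apply: hy].
- move=> a x aa hx; split=> J cJ r1 r2 r3; have [_ [_ [_ [hM _]]]] := cJ;
  by have [h1 h2] := hM a x aa (hx J cJ r1 r2 r3).
- move=> x ax h J cJ r1 r2 r3; have [_ [_ [_ [_ hL]]]] := cJ; apply: hL => // N.
  by have [y [hy e]] := h N; exists y; split=> //; apply: hy.
Qed.

(** * Constant terms in h of [psi] and [xi] *)

Hypothesis Hcol : colouring psi.

Lemma psi0 k n : (0 < k)%N -> psi k n 0%N = k%:R * (n - k%:Z + 1)%:~R.
Proof. by case: Hcol => h _ /h ->; rewrite !rmorphD rmorphN /=. Qed.

Lemma ps_prod0 (s : seq (ps K)) : ps_prod s 0%N = \prod_(f <- s) f 0%N.
Proof.
elim: s => [|f s IH]; first by rewrite big_nil.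
by rewrite big_cons -IH /= psM psM0.
Qed.

(** Each factor is [c (n - c + 1)] with [1 <= c <= k <= n], a positive integer. *)
Lemma prod_psi0_neq0 a k n : (a <= k)%N -> (k%:Z <= n)%R ->
  \prod_(c <- iota (k - a + 1) a) psi c n 0%N != 0.
Proof.
move=> ak kn; rewrite big_seq prodf_seq_neq0; apply/allP => c /=.
rewrite mem_iota => /[dup] h -> /=; rewrite psi0; last by lia.
rewrite mulf_eq0 negb_or -[c%:R]/(c%:Z%:~R : K) !intr_neq0 //; lia.
Qed.

(** The equation at h = 0 is solved recursively: index [k] determines [p k 0], whose coefficient is
    nonzero for large [n]. Vanishing from index 2 on rests on [(n - 2k) + k (n - k + 1) = (k + 1)(n
    - k)]. *)
Lemma p_classical : [/\ p 0 0 = 'X, p 1 0 = 1 & forall a, p a.+2 0%N = 0].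
Proof.
case: Hreg => hp _.
have lt0 k n : \sum_(a < k.+1) (\prod_(c <- iota (k - a + 1) a) psi c n 0%N) *
     (p a 0).[(n - (2 * k)%N%:Z)%:~R] = k.+1%:R * (n - k%:Z)%:~R.
  have -> : k.+1%:R * (n - k%:Z)%:~R = psi k.+1 n 0%N.
    by rewrite psi0 //; congr (_ * _%:~R); lia.
  rewrite -Hsol /ltimes; apply: eq_bigr => a _.
  by rewrite psM psM0 ps_prod0 big_map hp.
have p0 : p 0 0 = 'X.
  apply/eqP; rewrite -subr_eq0; apply/eqP/(poly_eq0_int char0 (z := 0)) => n _.
  have := lt0 0%N n; rewrite big_ord1 big_nil !mul1r !subr0 => e.
  by rewrite hornerD hornerN hornerX e subrr.
have p1 : p 1 0 = 1.
  apply/eqP; rewrite -subr_eq0; apply/eqP/(poly_eq0_int char0 (z := 0)) => n n0.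
  (* The shift by 2 evaluates [p 1 0] at [n], with coefficient [n + 2], nonzero for [n >= 0]. *)
  have := lt0 1%N (n + 2); rewrite !big_ord_recl big_ord0 /= big_nil big_seq1.
  rewrite p0 hornerX psi0 // mul1r addr0.
  have -> : n + 2 - (2 * 1)%N%:Z = n by lia.
  have -> : n + 2 - 1%N%:Z + 1 = n + 2 by lia.
  have -> : n + 2 - 1%N%:Z = n + 1 by lia.
  rewrite mul1r !rmorphD /= => e.
  have nz : (n + 2)%:~R != 0 :> K by apply: intr_neq0 => //; lia.
  apply: (mulfI nz); rewrite mulr0 hornerD hornerN hornerC rmorphD /=.
  by rewrite mulrBr -[X in X - _](addKr n%:~R) e; ring.
split=> // a; elim/ltn_ind: a => a IH.
apply: (poly_eq0_int char0 (z := (a.+2)%:Z)) => n hn.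
(* The shift makes the top polynomial be evaluated at [n]. By induction only the terms of index 0
   and 1 remain beside it. *)
have := lt0 a.+2 (n + (2 * a.+2)%N%:Z).
rewrite addrK big_ord_recr /= !big_ord_recl [X in _ + (_ + X) + _]big1 => [|i _]; last first.
  by rewrite /= /bump /= IH ?horner0 ?mulr0.
rewrite /= big_nil p0 hornerX p1 hornerC mul1r addr0.
rewrite -[_ :: _ :: _]/(iota (a.+2 - a.+2 + 1) a.+2).
have -> : (a.+2 - bump 0 0 + 1 = a.+2)%N by rewrite /bump /=; lia.
rewrite big_seq1 psi0 // mulr1.
set P := \prod_(_ <- _) _; have nz : P != 0 by apply: prod_psi0_neq0; lia.
move=> e; apply: (mulfI nz); rewrite mulr0.
move: e => /(congr1 (fun t => t - (n%:~R + a.+2%:R * (n + (2 * a.+2)%N%:Z - a.+2%:Z + 1)%:~R))).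
rewrite [_ + P * _]addrC addrK => ->.
have -> : n + (2 * a.+2)%N%:Z - a.+2%:Z = n + a.+2%:Z by lia.
rewrite !rmorphD /= -[a.+2%:~R]/(a.+2%:R : K) -!natr1; ring.
Qed.

End Regular.

(** * Normal ordering modulo h *)

Section LeftMultiplication.
Variable K : fieldType.
Implicit Types (u v : word -> K) (f : {poly K}).

Definition lmul (g : 'I_3) u : word -> K :=
  fun w => if w is c :: w' then (c == g)%:R * u w' else 0.

Definition conv u v : word -> K :=
  fun w => \sum_(s < (size w).+1) u (take s w) * v (drop s w).

Lemma fmul0E (x y : fs K) w : fmul x y 0%N w = conv (x 0%N) (y 0%N) w.
Proof. by rewrite /fmul big_ord1. Qed.

Lemma conv_lin u v w' (c : K) w :
  conv (fun w => u w + c * v w) w' w = conv u w' w + c * conv v w' w.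
Proof.
rewrite /conv big_distrr -big_split; apply: eq_bigr => s _ /=; ring.
Qed.

Lemma conv_delta_nil u : conv (delta K [::]) u = u.
Proof.
apply: funext => w; rewrite /conv big_ord_recl big1 => [|s _]; last first.
  by case: w s => [[[]]//|c w s]; rewrite /delta /= mul0r.
by rewrite /delta /= take0 drop0 eqxx mul1r addr0.
Qed.

Lemma conv_delta_cons g (v : word) u :
  conv (delta K (g :: v)) u = lmul g (conv (delta K v) u).
Proof.
apply: funext => -[|c w]; first by rewrite /conv big_ord1 /delta /= mul0r.
rewrite /conv big_ord_recl /delta /= mul0r add0r big_distrr.
by apply: eq_bigr => s _ /=; rewrite eqseq_cons; case: eqP; rewrite ?mul1r ?mul0r.
Qed.

Definition convE := (conv_delta_cons, conv_delta_nil).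

(* The element (X^-)^a (X^+)^b f(H). *)
Definition nmon a b f : word -> K :=
  fun w => (w == normal_word a b (count_mem lH w))%:R * f`_(count_mem lH w).

Lemma nmonSa a b f : nmon a.+1 b f = lmul lXm (nmon a b f).
Proof.
have [e1 e2 e3] := letters_neq.
apply: funext => -[|c w]; first by rewrite /nmon mul0r.
rewrite /nmon /lmul /= eqseq_cons; case: eqP => [->|]; last by rewrite !mul0r.
by rewrite [lXm == lH]eq_sym e1 mul1r.
Qed.

Lemma nmonSb b f : nmon 0 b.+1 f = lmul lXp (nmon 0 b f).
Proof.
have [e1 e2 e3] := letters_neq.
apply: funext => -[|c w]; first by rewrite /nmon mul0r.
rewrite /nmon /lmul /= eqseq_cons; case: eqP => [->|]; last by rewrite !mul0r.
by rewrite [lXp == lH]eq_sym e2 mul1r.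
Qed.

Lemma nmonX f : nmon 0 0 ('X * f) = lmul lH (nmon 0 0 f).
Proof.
apply: funext => -[|c w]; first by rewrite /nmon /= coefXM mulr0.
rewrite /nmon /lmul /=; case: (c =P lH) => [->|ne] /=.
  by rewrite coefXM mul1r /normal_word /= eqseq_cons eqxx.
rewrite mul0r /normal_word /= add0n; case: (count _ w) => [|i] /=; first by rewrite mul0r.
by rewrite eqseq_cons; case: eqP => //; rewrite mul0r.
Qed.

Lemma nmonD a b f g w : nmon a b (f + g) w = nmon a b f w + nmon a b g w.
Proof. by rewrite /nmon coefD mulrDr. Qed.

Lemma nmonZ a b (c : K) f w : nmon a b (c *: f) w = c * nmon a b f w.
Proof. by rewrite /nmon coefZ mulrCA. Qed.

Lemma count_normal_word a b i :
  [/\ count_mem lXm (normal_word a b i) = a, count_mem lXp (normal_word a b i) = b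
    & count_mem lH (normal_word a b i) = i].
Proof.
have [e1 e2 e3] := letters_neq.
rewrite /normal_word !count_cat !count_nseq /= !eqxx.
by rewrite [lXm == lH]eq_sym e1 [lXp == lH]eq_sym e2 [lXp == lXm]eq_sym e3 !mul0n !mul1n !addn0.
Qed.

Lemma nmon_size a b f w : (a + (b + size f) < size w)%N -> nmon a b f w = 0.
Proof.
rewrite /nmon; case: eqP => [e|]; last by rewrite mul0r.
have := congr1 size e; rewrite size_normal_word => ->.
by rewrite !ltn_add2l => /ltnW h; rewrite nth_default ?mulr0.
Qed.

Lemma nmon_sum a b f D w : (size f <= D)%N ->
  nmon a b f w = \sum_(i < D) f`_i * (w == normal_word a b i)%:R.
Proof.
move=> h; rewrite /nmon; case: eqP => [e|ne]; last first.
  rewrite mul0r big1 // => i _; case: eqP => [e|]; last by rewrite mulr0.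
  by case: ne; rewrite {1}e; have [_ _ <-] := count_normal_word a b i; rewrite -e.
have hi i : (w == normal_word a b i) = (i == count_mem lH w).
  apply/eqP/eqP => [->|->] //; by have [_ _ ->] := count_normal_word a b i.
under eq_bigr => i _ do rewrite hi.
case: (ltnP (count_mem lH w) D) => [lt|ge].
  rewrite (bigD1 (Ordinal lt)) //= eqxx mulr1 mul1r big1 ?addr0 // => i ne.
  by case: eqP => [e'|]; rewrite ?mulr0 //; case/eqP: ne; apply: val_inj.
rewrite nth_default ?(leq_trans h) // mulr0 big1 // => i _.
by case: eqP => [e'|]; rewrite ?mulr0 //; have := ltn_ord i; lia.
Qed.

End LeftMultiplication.

Section Classical.
Variables (K : fieldType) (char0 : [pchar K] =i pred0).
Variables (psi xi : nat -> int -> ps K) (p : nat -> nat -> {poly K}).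
Hypotheses (Hcol : colouring psi) (Hreg : regular_with xi p) (Hsum : summable xi).
Hypothesis Hsol : forall k n m, ltimes psi xi k n m = psi k.+1 n m.
Implicit Types (u v : word -> K) (f : {poly K}).

(* Constant terms in h of the elements of the relation ideal. *)
Definition lead_ideal u := exists2 j, in_rel_ideal p j & forall w, j 0%N w = u w.

Definition bounded_supp u := exists L, forall w, (L < size w)%N -> u w = 0.

Definition lift u : fs K := fun m w => if m == 0%N then u w else 0.

Lemma isA_lift u : bounded_supp u -> isA (lift u).
Proof.
move=> [L hL]; apply/isAP => M; exists L => m w _ h.
by rewrite /lift hL // if_same.
Qed.

Let closed_ideal_rel := closed_rel_ideal char0 Hreg Hsum Hsol.

Lemma I_mul a x : isA a -> in_rel_ideal p x ->
  in_rel_ideal p (fmul a x) /\ in_rel_ideal p (fmul x a).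
Proof. by have [_ [_ [_ [h _]]]] := closed_ideal_rel; apply: h. Qed.

Lemma lead_ideal_lin u v (c : K) :
  lead_ideal u -> lead_ideal v -> lead_ideal (fun w => u w + c * v w).
Proof.
move=> [x hx ex] [y hy ey].
(* A closed ideal is assumed stable under sums and products only, so the scalar [c] acts as a
   multiple of the empty word. *)
have fd : bounded_supp (fun w => c * delta K [::] w).
  by exists 0%N => w h; rewrite delta_size // mulr0.
have [hy' _] := I_mul (isA_lift fd) hy.
have [_ [_ [hD _]]] := closed_ideal_rel.
exists (fadd x (fmul (lift (fun w => c * delta K [::] w)) y)); first exact: hD.
move=> w; rewrite /fadd ex fmul0E /lift /=.
have -> : (fun w => c * delta K [::] w) = (fun w => 0 * delta K [::] w + c * delta K [::] w).
  by apply: funext => w'; rewrite mul0r add0r.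
rewrite conv_lin conv_delta_nil ey; congr (_ + _).
by rewrite /conv big1 ?add0r // => s _; rewrite !mul0r.
Qed.

Lemma lead_ideal_0 : lead_ideal (fun _ => 0).
Proof. by have [_ [h _]] := closed_ideal_rel; exists (@fzero K). Qed.

Lemma lead_ideal_lmul g u : lead_ideal u -> lead_ideal (lmul g u).
Proof.
move=> [x hx ex]; have ag : isA (fgen K g).
  apply/isAP => M; exists 1%N => m w _ h; rewrite /fgen.
  by case: eqP => //= _; case: eqP => // e; rewrite e in h.
exists (fmul (fgen K g) x); first by have [] := I_mul ag hx.
by move=> w; rewrite fmul_fgen; case: w => //= c w; rewrite ex.
Qed.

Lemma lead_ideal_conv u v : lead_ideal u -> bounded_supp v -> lead_ideal (conv u v).
Proof.
move=> [x hx ex] hv; exists (fmul x (lift v)).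
  by have [] := I_mul (isA_lift hv) hx.
by move=> w; rewrite fmul0E (_ : x 0%N = u) //; apply: funext.
Qed.

Lemma rels_in_rel_ideal : [/\ in_rel_ideal p (rel1 K), in_rel_ideal p (rel2 K)
  & in_rel_ideal p (rel3 p)].
Proof. by split=> J cJ. Qed.

(** The relation multiplied on the right by [u] rewrites leading letters; [lead_ideal_lmul] carries
    such rewritings further inside words. *)
Lemma lead_ideal_HXp u : bounded_supp u ->
  lead_ideal (fun w => lmul lH (lmul lXp u) w - lmul lXp (lmul lH u) w - 2 * lmul lXp u w).
Proof.
move=> hu; have [r _ _] := rels_in_rel_ideal.
have /lead_ideal_conv/(_ hu) : lead_ideal (fun w =>
    delta K [:: lH; lXp] w + (-1) * delta K [:: lXp; lH] w
    + (-2) * delta K [:: lXp] w).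
  by exists (rel1 K) => // w; rewrite rel1E /=; ring.
congr lead_ideal; apply: funext => w; rewrite !conv_lin !convE; ring.
Qed.

Lemma lead_ideal_HXm u : bounded_supp u ->
  lead_ideal (fun w => lmul lH (lmul lXm u) w - lmul lXm (lmul lH u) w + 2 * lmul lXm u w).
Proof.
move=> hu; have [_ r _] := rels_in_rel_ideal.
have /lead_ideal_conv/(_ hu) : lead_ideal (fun w =>
    delta K [:: lH; lXm] w + (-1) * delta K [:: lXm; lH] w
    + 2 * delta K [:: lXm] w).
  by exists (rel2 K) => // w; rewrite rel2E /=; ring.
congr lead_ideal; apply: funext => w; rewrite !conv_lin !convE; ring.
Qed.

(** Modulo h the third relation thus becomes [[X^+, X^-] = H]. *)
Lemma xisum0 w : xisum p 0%N w = delta K [:: lXm; lXp] w + delta K [:: lH] w.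
Proof.
have [p0 p1 p2] := p_classical char0 Hreg Hsol Hcol.
rewrite (@xisum_bounded _ _ 0 2 2) //.
- rewrite !big_ord_recl !big_ord0 /= p0 p1 !coefX !coefC /=.
  by rewrite !mul0r !mul1r !addr0 !add0r addrC.
- by move=> [|[|a]] // m; rewrite leqn0 => /eqP->.
- move=> [|[|a]] m; rewrite leqn0 => /eqP->;
  by rewrite ?p0 ?p1 ?p2 ?size_polyX ?size_poly1 ?size_poly0.
Qed.

Lemma lead_ideal_XpXm u : bounded_supp u ->
  lead_ideal (fun w => lmul lXp (lmul lXm u) w - lmul lXm (lmul lXp u) w - lmul lH u w).
Proof.
move=> hu; have [_ _ r] := rels_in_rel_ideal.
have /lead_ideal_conv/(_ hu) : lead_ideal (fun w =>
    delta K [:: lXp; lXm] w + (-1) * delta K [:: lXm; lXp] w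
    + (-1) * delta K [:: lH] w).
  by exists (rel3 p) => // w; rewrite rel3E xisum0 /=; ring.
congr lead_ideal; apply: funext => w; rewrite !conv_lin !convE; ring.
Qed.

Lemma bounded_supp_nmon a b f : bounded_supp (nmon a b f).
Proof. by exists (a + (b + size f))%N => w; exact: nmon_size. Qed.

(** Moving H to the right past (X^-)^a (X^+)^b adds the weight [2b - 2a]; each induction step
    commutes H with one letter. *)
Lemma lead_ideal_H_nmon a b f :
  lead_ideal (fun w => lmul lH (nmon a b f) w
     - nmon a b ('X * f + (2 * b%:R - 2 * a%:R) *: f) w).
Proof.
elim: a => [|a IH]; last first.
  have := lead_ideal_lin 1 (lead_ideal_HXm (bounded_supp_nmon a b f)) (lead_ideal_lmul lXm IH).
  congr lead_ideal; apply: funext => w; rewrite !nmonSa.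
  case: w => [|c w] /=; first by ring.
  rewrite !nmonD !nmonZ -natr1; ring.
elim: b => [|b IH]; last first.
  have := lead_ideal_lin 1 (lead_ideal_HXp (bounded_supp_nmon 0 b f)) (lead_ideal_lmul lXp IH).
  congr lead_ideal; apply: funext => w; rewrite !nmonSb.
  case: w => [|c w] /=; first by ring.
  rewrite !nmonD !nmonZ -natr1; ring.
have := lead_ideal_0; congr lead_ideal; apply: funext => w.
by rewrite mulr0 subrr scale0r addr0 nmonX subrr.
Qed.

(** This is the sl_2 identity [[X^+, (X^-)^a] = a (X^-)^(a-1) (H - a + 1)], with H then moved past
    (X^+)^b, which adds [2b]. At [a = 0] the factor [a] cancels the term with the truncated
    exponent. *)
Lemma lead_ideal_Xp_nmon a b f :
  lead_ideal (fun w => lmul lXp (nmon a b f) w - nmon a b.+1 f w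
     - nmon a.-1 b (a%:R *: ('X * f + (2 * b%:R - a%:R + 1) *: f)) w).
Proof.
elim: a => [|a IH].
  have := lead_ideal_0; congr lead_ideal; apply: funext => w.
  by rewrite nmonSb nmonZ; ring.
have := lead_ideal_lin 1 (lead_ideal_lin 1 (lead_ideal_XpXm (bounded_supp_nmon a b f))
  (lead_ideal_lmul lXm IH)) (lead_ideal_H_nmon a b f).
congr lead_ideal; apply: funext => w; rewrite !nmonSa /=.
have e : a%:R * lmul lXm (nmon a.-1 b ('X * f + (2 * b%:R - a%:R + 1) *: f)) w =
   a%:R * nmon a b ('X * f + (2 * b%:R - a%:R + 1) *: f) w :> K.
  by case: (a) => [|a'] /=; rewrite ?mul0r // nmonSa.
have e2 : lmul lXm (fun w => lmul lXp (nmon a b f) w - nmon a b.+1 f w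
     - nmon a.-1 b (a%:R *: ('X * f + (2 * b%:R - a%:R + 1) *: f)) w) w =
   lmul lXm (lmul lXp (nmon a b f)) w - lmul lXm (nmon a b.+1 f) w
     - a%:R * lmul lXm (nmon a.-1 b ('X * f + (2 * b%:R - a%:R + 1) *: f)) w.
  by case: w e => [|c w] _ /=; rewrite ?nmonZ; ring.
rewrite e2 e !(nmonZ, nmonD) -natr1; ring.
Qed.

Definition nsum (s : seq (nat * nat * {poly K})) : word -> K :=
  fun w => \sum_(t <- s) nmon t.1.1 t.1.2 t.2 w.

Definition normalizable u := exists s, lead_ideal (fun w => u w - nsum s w).

Lemma normalizable_eqv u v :
  lead_ideal (fun w => u w - v w) -> normalizable v -> normalizable u.
Proof.
move=> h [s hs]; exists s; have := lead_ideal_lin 1 h hs.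
by congr lead_ideal; apply: funext => w; ring.
Qed.

Lemma normalizableD u v :
  normalizable u -> normalizable v -> normalizable (fun w => u w + v w).
Proof.
move=> [s hs] [t ht]; exists (s ++ t); have := lead_ideal_lin 1 hs ht.
by congr lead_ideal; apply: funext => w; rewrite /nsum big_cat /=; ring.
Qed.

Lemma normalizable_nmon a b f : normalizable (nmon a b f).
Proof.
exists [:: (a, b, f)]; have := lead_ideal_0.
by congr lead_ideal; apply: funext => w; rewrite /nsum big_seq1 subrr.
Qed.

Lemma normalizable0 : normalizable (fun _ => 0).
Proof.
exists [::]; have := lead_ideal_0.
by congr lead_ideal; apply: funext => w; rewrite /nsum big_nil subr0.
Qed.

Lemma normalizable_lmul_nmon g a b f : normalizable (lmul g (nmon a b f)).
Proof.
case: (letterP g) => ->.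
- apply: normalizable_eqv (lead_ideal_H_nmon a b f) _; exact: normalizable_nmon.
- rewrite -nmonSa; exact: normalizable_nmon.
- apply: (@normalizable_eqv _ (fun w => nmon a b.+1 f w +
     nmon a.-1 b (a%:R *: ('X * f + (2 * b%:R - a%:R + 1) *: f)) w)).
    have := lead_ideal_Xp_nmon a b f.
    by congr lead_ideal; apply: funext => w; ring.
  by apply: normalizableD; exact: normalizable_nmon.
Qed.

Lemma normalizable_lmul g u : normalizable u -> normalizable (lmul g u).
Proof.
move=> [s hs]; apply: (@normalizable_eqv _ (lmul g (nsum s))).
  have := lead_ideal_lmul g hs; congr lead_ideal; apply: funext => -[|c w] /=; by ring.
elim: s {hs} => [|t s IH].
  have := normalizable0; congr normalizable; apply: funext => -[|c w] //=.
  by rewrite /nsum big_nil mulr0.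
have := normalizableD (normalizable_lmul_nmon g t.1.1 t.1.2 t.2) IH.
congr normalizable; apply: funext => -[|c w] /=; first by rewrite addr0.
by rewrite /nsum big_cons mulrDr.
Qed.

(** Sort words by first letter: [u] is its constant term plus, for each letter [g], a left multiple
    by [g] of a function supported on shorter words. *)
Lemma bounded_supp_normalizable u : bounded_supp u -> normalizable u.
Proof.
(* With the first length at which [u] must vanish as parameter, the induction starts at [u = 0]. *)
move=> [L hL]; have {hL} : forall w, (L.+1 <= size w)%N -> u w = 0 by [].
elim: {L}L.+1 u => [|L IH] u hu.
  have := normalizable0; congr normalizable; apply: funext => w.
  by rewrite hu.
have hg g : normalizable (lmul g (fun w => u (g :: w))).
  by apply: normalizable_lmul; apply: IH => w h; apply: hu.
have := normalizableD (normalizable_nmon 0 0 (u [::])%:P)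
   (normalizableD (hg lH) (normalizableD (hg lXm) (hg lXp))).
have [e1 e2 e3] := letters_neq.
congr normalizable; apply: funext => -[|c w].
  by rewrite /nmon /= coefC /= mul1r !addr0.
have -> : nmon 0 0 (u [::])%:P (c :: w) = 0.
  rewrite /nmon; case: eqP => [|]; last by rewrite mul0r.
  by move=> e; rewrite coefC; case: eqP e => [->//|]; rewrite mulr0.
rewrite /= add0r; case: (letterP c) => ->; rewrite !eqxx;
by rewrite ?[lXm == lH]eq_sym ?[lXp == lH]eq_sym ?[lXp == lXm]eq_sym ?e1 ?e2 ?e3
  !mul0r ?mul1r ?addr0 ?add0r.
Qed.

(** The list may repeat a pair of exponents, so only the collected polynomials can be shown to
    vanish. *)
Definition ncoef (s : seq (nat * nat * {poly K})) a b : {poly K} :=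
  \sum_(t <- s | (t.1.1 == a) && (t.1.2 == b)) t.2.

Lemma nsum_ncoef s w : nsum s w = nmon (count_mem lXm w) (count_mem lXp w)
   (ncoef s (count_mem lXm w) (count_mem lXp w)) w.
Proof.
rewrite /nsum /ncoef /nmon coef_sum big_distrr [RHS]big_mkcond.
apply: eq_bigr => t _ /=.
case: ifP => [/andP[/eqP-> /eqP->] //|hF]; case: eqP => [e|]; last by rewrite mul0r.
have [e1 e2 _] := count_normal_word t.1.1 t.1.2 (count_mem lH w).
by rewrite -e in e1 e2; rewrite e1 e2 !eqxx in hF.
Qed.

(** * Elements acting by zero *)

Definition ccoef (n : int) k b : K := \prod_(r < b) qXp psi n (k - r) 0%N.

Lemma ps_prod_ord b (F : 'I_b -> ps K) : (\prod_(r < b) F r) 0%N = \prod_(r < b) F r 0%N.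
Proof.
by elim/big_rec2: _ => // i y1 y2 _ <-; rewrite psM0.
Qed.

Lemma wcoef_normal0 n a b i k j : wcoef psi n (normal_word a b i) k j 0%N =
  (n - (2 * k)%N%:Z)%:~R ^+ i * (ccoef n k b * ((k - b + a)%N == j)%:R).
Proof.
rewrite /wcoef wact_normal /=; case: eqP => _; last by rewrite !mulr0.
by rewrite psM0 ps_prod_ord mulr1.
Qed.

(** Since H^i acts on [b_k] by the i-th power of its weight, the sum over words turns each
    polynomial into its value at [n - 2k]. *)
Lemma nsum_action0 s : (exists N, forall n k j B, (N <= B)%N ->
    wsum B (fun w => nsum s w * wcoef psi n w k j 0%N) = 0) ->
  forall n k j, \sum_(t <- s) t.2.[(n - (2 * k)%N%:Z)%:~R] *
    (ccoef n k t.1.2 * ((k - t.1.2 + t.1.1)%N == j)%:R) = 0.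
Proof.
move=> [N hN] n k j.
pose D := \max_(t <- s) (t.1.1 + (t.1.2 + size t.2))%N.
have hD t : t \in s -> (t.1.1 + (t.1.2 + size t.2) <= D)%N.
  by move=> ts; rewrite /D (big_rem t) //= leq_maxl.
rewrite -[RHS](hN n k j (maxn N D) (leq_maxl _ _)) /nsum.
under [RHS]eq_wsum => w do rewrite big_distrl.
rewrite wsum_sum big_seq [RHS]big_seq; apply: eq_bigr => t /hD ht /=.
under [RHS]eq_wsum => w do rewrite (nmon_sum _ _ _ (leqnn _)) big_distrl.
rewrite wsum_sum horner_coef big_distrl; apply: eq_bigr => i _ /=.
under eq_wsum => w do rewrite -mulrA.
rewrite wsumMl wsum_delta ?wcoef_normal0 ?mulrA // size_normal_word.
rewrite (leq_trans _ (leq_maxr N D)) // (leq_trans _ ht) //.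
by rewrite !leq_add2l ltnW.
Qed.

Lemma ccoef_gt n k b : (k < b)%N -> ccoef n k b = 0.
Proof. by move=> h; rewrite /ccoef -(ps_prod_ord (fun r => qXp psi n (_ - r)%N)) prod_qXp_gt. Qed.

Lemma ccoef_neq0 n b : (b%:Z <= n)%R -> ccoef n b b != 0.
Proof.
move=> h; rewrite /ccoef -(ps_prod_ord (fun r => qXp psi n (_ - r)%N)) prod_qXp // ps_prod0 big_map.
by apply: (prod_psi0_neq0 char0 Hcol).
Qed.

(** Linear independence of the PBW monomials: the coefficient of [b_a] in the action on [b_b]
    isolates [ncoef s a b], which then vanishes at infinitely many weights. *)
Lemma ncoef_eq0 s :
  (forall n k j, \sum_(t <- s) t.2.[(n - (2 * k)%N%:Z)%:~R] *
    (ccoef n k t.1.2 * ((k - t.1.2 + t.1.1)%N == j)%:R) = 0) ->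
  forall b a, ncoef s a b = 0.
Proof.
move=> h; elim/ltn_ind => b IH a.
(* On b_b the monomials with more than b factors X^+ vanish, and those with
   fewer have zero coefficient by induction. *)
apply: (poly_eq0_int char0 (z := - b%:Z)) => n hn.
(* The highest weight [n + 2b] gives [b_b] the weight [n]; it is at least [b], so [ccoef] is
   nonzero. *)
have := h (n + (2 * b)%N%:Z) b a; rewrite addrK; set z := n%:~R; set n' := (n + _).
have nz : ccoef n' b b != 0 by apply: ccoef_neq0; rewrite /n'; lia.
move=> e; apply: (mulIf nz); rewrite mul0r -[RHS]e.
pose G t : K := t.2.[z] * (ccoef n' b t.1.2 * ((b - t.1.2 + t.1.1)%N == a)%:R).
rewrite -/(G _).
(* Reaching [b_a] from [b_b] with [c] factors X^+ takes [a + c - b] factors X^-; the indicator of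
   [b <= a + c] corrects the truncated subtraction. *)
have split t : G t = \sum_(c < b.+1 | (t.1.1 == a + c - b)%N && (t.1.2 == c))
     (b <= a + c)%N%:R * (t.2.[z] * ccoef n' b c).
  rewrite /G; case: (leqP t.1.2 b) => [le|gt]; last first.
    rewrite ccoef_gt // mul0r mulr0 big1 // => c /andP[_ /eqP e'].
    by move: gt; rewrite e' ltnNge -ltnS ltn_ord.
  rewrite big_mkcond (bigD1 (Ordinal (n := b.+1) (m := t.1.2) le)) //= big1 ?addr0.
    rewrite eqxx andbT; case: eqP => e1; case: eqP => e2.
    - by rewrite (_ : (b <= a + t.1.2)%N = true) ?mulr1 ?mul1r //; lia.
    - lia.
    - by rewrite (_ : (b <= a + t.1.2)%N = false) ?mulr0 ?mul0r //; lia.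
    - by rewrite !mulr0.
  by move=> c ne; case: ifP => // /andP[_ /eqP e']; case/eqP: ne; apply: val_inj.
under [RHS]eq_bigr => t _ do rewrite -/(G t) split.
rewrite (exchange_big_dep xpredT) //= big_ord_recr /= [X in X + _]big1 ?add0r.
  rewrite addnK leq_addl -big_distrr /= mul1r -big_distrl /= /ncoef.
  by rewrite horner_sum.
move=> c _; rewrite -big_distrr -big_distrl /= -horner_sum.
by rewrite -/(ncoef s _ _) IH // horner0 mul0r mulr0.
Qed.

(** Both [x] and [j] act by zero, so the difference [nsum s] of their constant terms acts by zero at
    h = 0. *)
Lemma annihilates_low x j : kernel psi x -> in_rel_ideal p j -> forall s,
  (forall w, j 0%N w = x 0%N w - nsum s w) -> forall w, nsum s w = 0.
Proof.
move=> [ax kx] hj s e.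
have [aj kj] := rel_ideal_kernel char0 Hreg Hsum Hsol hj.
suff h0 : forall b a, ncoef s a b = 0.
  by move=> w; rewrite nsum_ncoef h0 /nmon coef0 mulr0.
apply: ncoef_eq0; apply: nsum_action0.
have /isAP/(_ 0%N)[A hA] := ax; have /isAP/(_ 0%N)[B hB] := aj.
exists (maxn A B) => n k l C; rewrite geq_max => /andP[hAC hBC].
have := kx n k l 0%N C (supp_boundW hAC hA); have := kj n k l 0%N C (supp_boundW hBC hB).
rewrite /act; under eq_wsum => w do rewrite psM0.
move=> hj0; under eq_wsum => w do rewrite psM0.
move=> hx0.
have -> : (fun w => nsum s w * wcoef psi n w k l 0%N) = (fun w =>
     x 0%N w * wcoef psi n w k l 0%N + (-1) * (j 0%N w * wcoef psi n w k l 0%N)).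
  by apply: funext => w; rewrite e; ring.
by rewrite wsumD wsumMl hx0 hj0 mulr0 addr0.
Qed.

Lemma leading_term x : kernel psi x ->
  exists2 j, in_rel_ideal p j & forall w, j 0%N w = x 0%N w.
Proof.
move=> kx; have /isAP/(_ 0%N)[A hA] := kx.1.
have [s [j hj e]] : normalizable (x 0%N).
  by apply: bounded_supp_normalizable; exists A => w; apply: hA.
by exists j => // w; rewrite e (annihilates_low kx hj e) subr0.
Qed.

(** * Division by h and h-adic approximation *)

Definition hshift (x : fs K) : fs K := fun m w => if m is m'.+1 then x m' w else 0.

Lemma isA_hshift x : isA x -> isA (hshift x).
Proof.
move=> /isAP hx; apply/isAP => M; have [B hB] := hx M; exists B => -[|m] w // mM h.
by apply: hB => //; exact: ltnW.
Qed.

Definition hvar : fs K := hshift (lift (delta K [::])).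

Lemma fmul_hone x : fmul hvar x = hshift x.
Proof.
apply: funext => -[|m]; apply: funext => w.
  by rewrite fmul0E /conv /= big1 // => s _; rewrite mul0r.
rewrite /fmul big_ord_recl [X in X + _]big1 ?add0r => [|s _]; last by rewrite mul0r.
rewrite big_ord_recl [X in _ + X]big1 ?addr0 => [|i _].
  by rewrite /= /bump /= subn1 /=; exact: (congr1 (fun u => u w) (conv_delta_nil (x m))).
by rewrite big1 // => s _; rewrite mul0r.
Qed.

Lemma I_hshift y : in_rel_ideal p y -> in_rel_ideal p (hshift y).
Proof.
move=> hy; rewrite -fmul_hone; apply: (I_mul _ hy).1.
apply/isA_hshift/isA_lift; exists 0%N => w h; by rewrite delta_size.
Qed.

(** The modules have no h-torsion: the coefficient of h^M for [y] is that of h^(M+1) for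
    [hshift y]. *)
Lemma annihilates_hshift n y : annihilates psi n (hshift y) -> annihilates psi n y.
Proof.
move=> h k j M B hB; rewrite -(h k j M.+1 B); last first.
  by move=> [|m] w // mM; apply: hB.
apply: eq_wsum => w; change (pmul (y^~ w) (wcoef psi n w k j) M =
  pmul (hshift y ^~ w) (wcoef psi n w k j) M.+1).
by rewrite /pmul [RHS]big_ord_recl mul0r add0r; apply: eq_bigr => i _.
Qed.

Lemma kernel_approx N x : kernel psi x -> exists y, in_rel_ideal p y /\ agree N x y.
Proof.
elim: N x => [|N IH] x kx.
  by have [_ [h _]] := closed_ideal_rel; exists (@fzero K).
have [j hj e0] := leading_term kx.
have kj := rel_ideal_kernel char0 Hreg Hsum Hsol hj.
pose d : fs K := fun m w => x m w + (-1) * j m w.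
have kd : kernel psi d.
  split; first by apply: isA_lin; [exact: kx.1|exact: kj.1].
  by move=> n; apply: annihilates_lin; [exact: kx.1|exact: kj.1|exact: kx.2|exact: kj.2].
pose x1 : fs K := fun m w => d m.+1 w.
have ed : d = hshift x1.
  by apply: funext => -[|m]; apply: funext => w //; rewrite /d /= e0 mulN1r subrr.
have kx1 : kernel psi x1.
  split=> [|n]; last by apply: annihilates_hshift; rewrite -ed; exact: kd.2.
  apply/isAP => M; have /isAP/(_ M.+1)[B hB] := kd.1.
  by exists B => m w mM; apply: hB.
have [y1 [hy1 e1]] := IH _ kx1.
(* Here [x = j + h x1], so agreement of [x1] and [y1] below degree [N] gains one order. *)
exists (fadd j (hshift y1)); split.
  by have [_ [_ [hD _]]] := closed_ideal_rel; apply: hD => //; exact: I_hshift.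
move=> [|m] w mN; rewrite /fadd /= ?addr0 ?e0 //.
by rewrite -e1 // /x1 /d; ring.
Qed.

Lemma kernel_rel_ideal x : kernel psi x -> in_rel_ideal p x.
Proof.
move=> kx; have [_ [_ [_ [_ h]]]] := closed_ideal_rel.
by apply: h; [exact: kx.1|move=> N; exact: kernel_approx].
Qed.

End Classical.

(* The natural map A = k<H,X^-,X^+>[[h]] -> U_h(psi) is surjective; the
   theorem says it induces an isomorphism A/I -> U_h(psi), i.e. its kernel
   (elements acting by zero on all V_h(n,psi)) is exactly I. *)
Theorem mainTheorem8 (K : fieldType) (char0 : [pchar K] =i pred0)
  (psi : nat -> int -> ps K)
  (Hcol : colouring psi) (Hreg : regular_colouring psi)
  (xi : nat -> int -> ps K) (p : nat -> nat -> {poly K})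
  (Hxireg : regular_with xi p) (Hxisum : summable xi)
  (Hsol : forall (k : nat) (n : int) (m : nat), ltimes psi xi k n m = psi k.+1 n m) :
  forall x : fs K, isA x ->
    (in_rel_ideal p x <-> forall n : int, acts_zero psi n x).
Proof.
move=> x ax; split=> [/(rel_ideal_kernel char0 Hxireg Hxisum Hsol)[_ kx] n|h].
  exact/acts_zeroP.
apply: (kernel_rel_ideal char0 Hcol Hxireg Hxisum Hsol); split=> // n.
exact/acts_zeroP.
Qed.
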